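(* Let $G$ be an open quasi-Polish groupoid and $X$ a quasi-Polish space equipped with a continuous map $p : X \to G_0$ and a Borel action $\alpha : G \times_{G_0} X \to X$ of $G$. Then: (a) $\alpha$ is continuous if and only if $\mathcal{O}(G) \circledast \mathcal{O}(X) = \mathcal{O}(X)$, i.e., the sets $U * A$ for $U \in \mathcal{O}(G)$, $A \in \mathcal{O}(X)$ are open and form an open (sub)basis of $X$; (b) if $\mathcal{O}(G) \circledast \mathcal{O}(X) \subseteq \mathcal{O}(X)$, then $\mathcal{O}(G) \circledast \mathcal{O}(X)$ is a coarser compatible quasi-Polish topology on $X$ for which $p$ is still continuous and the action is continuous.
   Context: A quasi-Polish groupoid is a groupoid $G$ (with object space $G_0$, morphism space $G$, source $\sigma$, target $\tau$, multiplication, identity and inverse maps) such that $G$ and $G_0$ carry topologies, all structure maps are continuous, and $G$ is a quasi-Polish space (de Brecht). It is open if $\sigma : G \to G_0$ is an open map. An action of $G$ on $p : X \to G_0$ is a map $\alpha : G \times_{G_0} X \to X$, where $G \times_{G_0} X := \{(g,a) \in G \times X \mid \sigma(g) = p(a)\}$, written $\alpha(g,a) = ga$, with $p(ga) = \tau(g)$ and satisfying associativity and identity axioms. Vaught transform: for Borel $U \subseteq G$ and Borel $A \subseteq X$, $U * A := \{a \in X \mid \exists^* g \in \tau^{-1}(p(a))\,(g \in U \text{ and } a \in gA)\}$, where $\exists^*$ means ''for a nonmeager set'' in the subspace $\tau^{-1}(p(a)) \subseteq G$. $\mathcal{O}(G) \circledast \mathcal{S}$ is the family of countable unions $\bigcup_i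 (U_i * A_i)$ with $U_i$ open and $A_i \in \mathcal{S}$. A compatible quasi-Polish topology is one contained in the Borel $\sigma$-algebra. *)

(* Defs.v *)
From HB Require Import structures.
From mathcomp Require Import all_boot all_order all_algebra.
From mathcomp Require Import all_classical all_reals all_analysis.

Set Implicit Arguments.
Unset Strict Implicit.
Unset Printing Implicit Defensive.

Import Order.TTheory GRing.Theory Num.Theory.

Local Open Scope classical_set_scope.
Local Open Scope ring_scope.

Definition quasi_metric (R : realType) (T : Type) (d : T -> T -> R) :=
  [/\ forall x y, 0 <= d x y,
      forall x y, x = y <-> d x y = 0 /\ d y x = 0
    & forall x y z, d x z <= d x y + d y z].

(* Asymmetric: only [n <= m] is required. *)
Definition quasi_cauchy (R : realType) (T : Type) (d : T -> T -> R)
    (u : nat -> T) :=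
  forall e, 0 < e ->
    exists N, forall n m, (N <= n)%N -> (n <= m)%N -> d (u n) (u m) < e.

(* Smyth completeness: convergence is for the symmetrized metric. *)
Definition quasi_complete (R : realType) (T : Type) (d : T -> T -> R) :=
  forall u : nat -> T, quasi_cauchy d u ->
    exists l, forall e, 0 < e ->
      exists N, forall n, (N <= n)%N -> Num.max (d (u n) l) (d l (u n)) < e.

Definition quasi_metric_open (R : realType) (T : Type) (d : T -> T -> R) :
    set (set T) :=
  [set U | forall x, U x -> exists2 e, 0 < e & [set y | d x y < e] `<=` U].

(* M. de Brecht's definition: countably based and completely
   quasi-metrizable. *)
Definition quasi_polish (R : realType) (T : topologicalType) :=
  @second_countable T /\
  exists d : T -> T -> R,
    [/\ quasi_metric d, @open T = quasi_metric_open d & quasi_complete d].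

Definition borel (T : topologicalType) : set (set T) := <<s @open T >>.

Definition borel_in (T : topologicalType) (D : set T) : set (set T) :=
  <<s D, [set D `&` U | U in @open T] >>.

Definition nowhere_dense (T : topologicalType) (A : set T) :=
  (closure A)° = set0.

Definition meager (T : topologicalType) (A : set T) :=
  exists2 N : nat -> set T,
    forall n, nowhere_dense (N n) & A = \bigcup_n N n.

(* [exists* x in F, P x]; [set_type F] carries the subspace topology. *)
Definition exists_star (T : topologicalType) (F : set T) (P : T -> Prop) :=
  ~ meager [set x : set_type F | P (\val x)].

Definition is_topology (X : Type) (O : set (set X)) :=
  [/\ O setT, setI_closed O
    & forall F : set (set X), F `<=` O -> O (\bigcup_(A in F) A)].

Definition subbasis (T : topologicalType) (B : set (set T)) :=
  B `<=` open /\ @open T = smallest (@is_topology T) B.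

(* The set [X] with the topology [O] in place of any topology it may have. *)
Definition retopology (X : Type) (O : set (set X)) (HO : is_topology O) :
  Type := X.

Section Retopology.
Variables (X : choiceType) (O : set (set X)) (HO : is_topology O).

Let opT : O [set: X]. Proof. by case: HO. Qed.

Let opI : setI_closed O. Proof. by case: HO. Qed.

Let op_bigU (I : Type) (f : I -> set X) :
  (forall i, O (f i)) -> O (\bigcup_i f i).
Proof.
move=> fO; have [_ _ OU] := HO.
have -> : \bigcup_i f i = \bigcup_(A in range f) A by rewrite bigcup_image.
by apply: OU => _ [i _ <-].
Qed.

HB.instance Definition _ := Choice.on (retopology HO).
HB.instance Definition _ :=
  isOpenTopological.Build (retopology HO) opT opI op_bigU.

Lemma open_retopology : @open (retopology HO) = O.
Proof. by []. Qed.

End Retopology.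

(* [mul g h] is relevant only when [src g = tgt h]; its other values are
   unconstrained. *)
Record groupoid (G0 G : Type) := Groupoid {
  src : G -> G0;
  tgt : G -> G0;
  mul : G -> G -> G;
  idm : G0 -> G;
  inv : G -> G;
  src_mul : forall g h, src g = tgt h -> src (mul g h) = src h;
  tgt_mul : forall g h, src g = tgt h -> tgt (mul g h) = tgt g;
  mul_assoc : forall g h k, src g = tgt h -> src h = tgt k ->
    mul g (mul h k) = mul (mul g h) k;
  src_idm : forall x, src (idm x) = x;
  tgt_idm : forall x, tgt (idm x) = x;
  mul_idml : forall g, mul (idm (tgt g)) g = g;
  mul_idmr : forall g, mul g (idm (src g)) = g;
  src_inv : forall g, src (inv g) = tgt g;
  tgt_inv : forall g, tgt (inv g) = src g;
  mul_invl : forall g, mul (inv g) g = idm (src g);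
  mul_invr : forall g, mul g (inv g) = idm (tgt g)
}.

Definition composable (G0 G : Type) (C : groupoid G0 G) : set (G * G) :=
  [set gh | src C gh.1 = tgt C gh.2].

Definition quasi_polish_groupoid (R : realType) (G0 G : topologicalType)
    (C : groupoid G0 G) :=
  [/\ continuous (src C), continuous (tgt C),
      {within composable C,
        continuous (fun gh : G * G => mul C gh.1 gh.2)},
      continuous (idm C) & continuous (inv C)] /\
  quasi_polish R G.

Definition open_groupoid (G0 G : topologicalType) (C : groupoid G0 G) :=
  forall U : set G, open U -> open (src C @` U).

(* [act g a] is relevant only when [src g = p a]; its other values are
   unconstrained. *)
Record groupoid_action (G0 G X : Type) (C : groupoid G0 G) (p : X -> G0) :=
  GroupoidAction {
    act :> G -> X -> X;
    act_proj : forall g a, src C g = p a -> p (act g a) = tgt C g;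
    act_mul : forall g h a, src C g = tgt C h -> src C h = p a ->
      act (mul C g h) a = act g (act h a);
    act_idm : forall a, act (idm C (p a)) a = a
  }.

Definition fiber_product (G0 G X : Type) (C : groupoid G0 G) (p : X -> G0) :
    set (G * X) :=
  [set ga | src C ga.1 = p ga.2].

Definition borel_action (G0 G X : topologicalType) (C : groupoid G0 G)
    (p : X -> G0) (alpha : groupoid_action C p) :=
  forall B : set X, borel B ->
    borel_in (fiber_product C p)
      (fiber_product C p `&` [set ga : G * X | B (alpha ga.1 ga.2)]).

Definition continuous_action (G0 G X : topologicalType) (C : groupoid G0 G)
    (p : X -> G0) (alpha : groupoid_action C p) :=
  {within fiber_product C p,
    continuous (fun ga : G * X => alpha ga.1 ga.2)}.

Definition translate (G0 G X : Type) (C : groupoid G0 G) (p : X -> G0)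
    (alpha : groupoid_action C p) (g : G) (A : set X) : set X :=
  [set alpha g b | b in A `&` [set b | src C g = p b]].

(* The Vaught transform [U * A]. *)
Definition vaught (G0 : Type) (G : topologicalType) (X : Type)
    (C : groupoid G0 G) (p : X -> G0) (alpha : groupoid_action C p)
    (U : set G) (A : set X) : set X :=
  [set a | exists_star (tgt C @^-1` [set p a])
             (fun g => U g /\ translate alpha g A a)].

Definition vaught_sets (G0 : Type) (G : topologicalType) (X : Type)
    (C : groupoid G0 G) (p : X -> G0) (alpha : groupoid_action C p)
    (S : set (set X)) : set (set X) :=
  [set B | exists U A, [/\ open U, S A & B = vaught alpha U A]].

(* Countable unions of sets [U * A], [U] open and [A] in [S]. *)
Definition vaught_unions (G0 : Type) (G : topologicalType) (X : Type)
    (C : groupoid G0 G) (p : X -> G0) (alpha : groupoid_action C p)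
    (S : set (set X)) : set (set X) :=
  [set B | exists F : set (set X),
    [/\ countable F, F `<=` vaught_sets alpha S & B = \bigcup_(V in F) V]].

(* Main.v *)
(* For [a] in [X] put [D A a := {g | tgt g = p a /\ A (g^-1 a)}], so that [a]
   lies in [U * A] iff [D A a] is nonmeager in [U] within the fiber of [tgt]
   over [p a].  Translating fibers by [g] and using a countable base of [G],
   [g a] lies in [U * A] iff some open [V] containing [g] and some open [W] with
   [V W] included in [U] satisfy: [a] lies in [W * A].  Hence the action is
   continuous for any topology generated by sets [U * A] which are all open.
   Conversely, for a continuous action Baire category on the fibers gives
   [U * A = U A], which is open because [src] is.

   For (b), stability under intersection comes from
   [V * (W1 * A1 :&: W2 * A2)], with [V] a neighbourhood of an identity.  Call
   [x] generic if it lies in [V * A] for all open [V] containing the identity of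
   [p x] and all open [A] containing [x].  Generic points form a Pi^0_2 set, and
   the action maps the pairs [(g, x)] with [x] generic continuously and openly
   onto [X] with the coarser topology, which is T0 since the sets [D A a] have
   the Baire property.  So everything reduces to de Brecht's theorem that a T0
   continuous open image of a quasi-Polish space is quasi-Polish; it is proved
   by transporting a countable convergent strategy for the strong Choquet
   game. *)

From HB Require Import structures.
From mathcomp Require Import all_boot all_order all_algebra.
From mathcomp Require Import all_classical all_reals all_analysis.
From mathcomp Require Import lra.
Require Import Defs.

Set Implicit Arguments.
Unset Strict Implicit.
Unset Printing Implicit Defensive.

Import Order.TTheory GRing.Theory Num.Theory.

Local Open Scope classical_set_scope.

(** * Countable bases *)

Definition indexed_base (T : topologicalType) (I : Type) (B : I -> set T) :=
  (forall i, open (B i)) /\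
  forall x U, open U -> U x -> exists2 i, B i x & B i `<=` U.

Lemma kolmogorovP (T : topologicalType) :
  kolmogorov_space T <->
  forall x y : T, (forall U, open U -> U x <-> U y) -> x = y.
Proof.
split=> H x y.
  move=> xy; apply/eqP; apply: contrapT => /negP /H[A]; rewrite !inE !nbhsE.
  by move=> [[[V [oV Vx] VA] nAy]|[[V [oV Vx] VA] nAx]];
    [apply/nAy/VA/(xy V oV) | apply/nAx/VA/(xy V oV)].
move=> xy; apply: contrapT => nA; move/eqP: xy; apply; apply: H => U oU.
split=> Uz; apply: contrapT => nU; apply: nA; exists U; rewrite !inE;
  [left|right]; by split=> //; apply: open_nbhs_nbhs.
Qed.

(** Only finitely many indices have a code below [q], so this is closure of a filter under finite
    intersections; bounds on codes play the part of finite index sets throughout. *)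
Lemma filter_forall_pickle (X : Type) (F : set_system X) (K : countType)
    (A : K -> set X) (q : nat) : Filter F -> (forall k, F (A k)) ->
  F [set y | forall k, (pickle k < q)%N -> A k y].
Proof.
move=> FF FA; elim: q => [|q IHq].
  by apply: filterS filterT => y _ k; rewrite ltn0.
have Fq : F [set y | forall k, pickle k = q -> A k y].
  have [[k kq]|nk] := pselect (exists k : K, pickle k = q).
    apply: filterS (FA k) => y Aky k'; rewrite -kq => /(pcan_inj pickleK) ->.
    exact: Aky.
  by apply: filterS filterT => y _ k kq; case: nk; exists k.
apply: filterS (filterI IHq Fq) => y [Hlt Heq] k.
by rewrite ltnS leq_eqVlt => /orP[/eqP/Heq|/Hlt].
Qed.

Lemma second_countable_base (T : topologicalType) (I : countType)
    (B : I -> set T) : indexed_base B -> @second_countable T.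
Proof.
move=> [Bo Bn]; exists (range B).
  by apply: sub_countable (card_image_le _ _) _.
split=> [_ [n _ <-]|x U]; first exact: Bo.
rewrite nbhsE => -[V [oV Vx] VU]; have [n Bnx BnV] := Bn x V oV Vx.
by exists (B n) => //=; [split=> //; exists n | exact: subset_trans VU].
Qed.

Lemma second_countableP (T : topologicalType) :
  @second_countable T <-> exists B : nat -> set T, indexed_base B.
Proof.
split=> [[Bs /countable_injP[f finj] [Bo Bn]]|[B]]; last first.
  exact: second_countable_base.
exists (fun n => \bigcup_(V in [set V | Bs V /\ f V = n]) V); split.
  by move=> n; apply: bigcup_open => V [/Bo].
move=> x U oU Ux; have /Bn[V [BV Vx] VU] : nbhs x U by apply: open_nbhs_nbhs.
exists (f V); first by exists V.
move=> y [V' [BV' ff] V'y]; apply: VU.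
by rewrite -(finj _ _ _ _ ff) ?inE.
Qed.

Lemma open_pointwise (T : topologicalType) (A : set T) :
  (forall x, A x -> exists U, [/\ open U, U x & U `<=` A]) -> open A.
Proof.
move=> H; rewrite openE => x /H[U [oU Ux UA]].
by rewrite /interior nbhsE; exists U.
Qed.

Lemma open_setX (T1 T2 : topologicalType) (A : set T1) (B : set T2) :
  open A -> open B -> open (A `*` B).
Proof.
move=> oA oB; rewrite openE => -[x y] [/= Ax By].
by exists (A, B) => //; split; exact: open_nbhs_nbhs.
Qed.

Lemma open_setX_base (T1 T2 : topologicalType) (U : set (T1 * T2)) x y :
  open U -> U (x, y) ->
  exists A B, [/\ open A, open B, A x, B y & A `*` B `<=` U].
Proof.
move=> oU Uxy; have : nbhs (x, y) U by apply: open_nbhs_nbhs.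
move=> [[V V'] [/= ]]; rewrite !nbhsE => -[A [oA Ax] AV] [B [oB Bx] BV] VU.
exists A, B; split=> // -[a b] [/= Aa Bb]; apply: VU.
by split; [exact: AV | exact: BV].
Qed.

Lemma continuous_withinP (T U : topologicalType) (A : set T) (f : T -> U) :
  {within A, continuous f} <->
  forall x V, A x -> open V -> V (f x) ->
    exists W, [/\ open W, W x & A `&` W `<=` f @^-1` V].
Proof.
rewrite subspace_continuousP; split=> H x.
  move=> V Ax oV Vfx.
  have : nbhs x [set y | A y -> V (f y)].
    exact: (H x Ax V (open_nbhs_nbhs (conj oV Vfx))).
  rewrite nbhsE => -[W [oW Wx] WV].
  by exists W; split=> // y [Ay Wy]; apply: WV.
move=> Ax V; rewrite nbhsE => -[V' [oV' V'x] V'V].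
have [W [oW Wx AW]] := H x V' Ax oV' V'x.
change (nbhs x [set y | A y -> V (f y)]).
rewrite nbhsE; exists W => // y Wy Ay.
by apply: V'V; apply: AW.
Qed.

Lemma basis_subbasis (T : topologicalType) (B : set (set T)) :
  basis B -> subbasis B.
Proof.
move=> [Bo Bn]; split=> //; apply/seteqP; split=> [U oU O1 [[_ _ O1U] BO1]|].
  rewrite (_ : U = \bigcup_(V in [set V | B V /\ V `<=` U]) V).
    by apply: O1U => V [/BO1].
  apply/seteqP; split=> [x Ux|x [V [_ VU] /VU]//].
  have /Bn[V [BV Vx] VU] : nbhs x U by apply: open_nbhs_nbhs.
  by exists V.
apply: smallest_sub => //; split; [exact: openT | exact: openI |].
by move=> F Fo; exact: bigcup_open.
Qed.

(** A Lindelöf argument: for each [c n] of a countable base, pick one member of [B] between [c n]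
    and [U] when there is one; the countably many picks cover [U]. *)
Lemma basis_countable_union (T : topologicalType) (B : set (set T)) :
  @second_countable T -> basis B -> forall U, open U ->
  exists F, [/\ countable F, F `<=` B & U = \bigcup_(V in F) V].
Proof.
move=> /second_countableP[c [co cn]] [Bo Bn] U oU.
pose good n V := [/\ B V, c n `<=` V & V `<=` U].
have /choice[g gP] : forall n, exists V, (exists V', good n V') -> good n V.
  move=> n; have [[V gV]|ng] := pselect (exists V', good n V').
    by exists V.
  by exists set0.
exists (g @` [set n | exists V', good n V']); split.
- exact: sub_countable (card_image_le _ _) _.
- by move=> _ [n /gP[? _ _] <-].
- apply/seteqP; split=> [x Ux|x [_ [n /gP[_ _ nU] <-] /nU]//].
  have /Bn[V [BV Vx] VU] : nbhs x U by apply: open_nbhs_nbhs.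
  have [n nx nV] := cn x V (Bo V BV) Vx.
  have gn : exists V', good n V' by exists V.
  by exists (g n); [exists n | have [_ + _] := gP n gn; exact].
Qed.

(** * Relative category *)

(** Nowhere density in the subspace [F], phrased with ambient open sets so that no subtype
    occurs. *)
Definition nowhere_dense_in (T : topologicalType) (F N : set T) :=
  forall U, open U -> F `&` U !=set0 ->
    exists V, [/\ open V, V `<=` U, F `&` V !=set0 & F `&` V `<=` ~` N].

Definition meager_in (T : topologicalType) (F N : set T) :=
  exists2 E : nat -> set T,
    forall n, nowhere_dense_in F (E n) & F `&` N `<=` \bigcup_n E n.

Lemma meager_inP (T : topologicalType) (F : set T) (P : T -> Prop) :
  meager [set x : set_type F | P (\val x)] <-> meager_in F P.
Proof.
split=> [[N Nnd PE]|[E End FE]].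
  exists (fun n => set_val @` N n) => [n U oU [x [Fx Ux]]|x [Fx Px]]; last first.
    have : [set x : set_type F | P (\val x)] (SigSub (mem_set Fx)) by [].
    rewrite PE => -[n _ Nn]; exists n => //.
    by exists (SigSub (mem_set Fx)).
  apply: contrapT => nV; suff : (closure (N n))° (SigSub (mem_set Fx)).
    by rewrite Nnd.
  rewrite /interior nbhsE; exists (set_val @^-1` U); first by split=> //; exists U.
  move=> y Uy W; rewrite nbhsE => -[_ [[W' oW' <-] W'y] W'W].
  apply: contrapT => /set0P/negP; rewrite negbK => /eqP NW.
  apply: nV; exists (U `&` W'); split=> //; first exact: openI.
    by exists (\val y); split=> //; exact: set_valP.
  move=> z [Fz [Uz W'z]] [z' Nz' zz']; suff : set0 z' by [].
  by rewrite -NW; split=> //; apply: W'W; rewrite /= zz'.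
exists (fun n => [set x | E n (\val x) /\ P (\val x)]); last first.
  apply/seteqP; split=> [x Px|x [n _ []]//].
  have [|n _ En] := FE (\val x); last by exists n.
  by split=> //; exact: set_valP.
move=> n; apply/seteqP; split=> // x; rewrite /interior nbhsE.
move=> [_ [[U oU <-] Ux] UN].
have [|V [oV VU [z [Fz Vz]] VE]] := End n U oU.
  by exists (\val x); split=> //; exact: set_valP.
have /UN /(_ (set_val @^-1` V)) [|w [[Ew _] Vw]] :
    (set_val @^-1` U) (SigSub (mem_set Fz) : set_type F) by apply: VU.
  by rewrite nbhsE; exists (set_val @^-1` V) => //; split=> //; exists V.
by apply: (VE (\val w)) => //; split=> //; exact: set_valP.
Qed.

Lemma nowhere_dense_in0 (T : topologicalType) (F : set T) :
  nowhere_dense_in F set0.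
Proof. by move=> U oU FU; exists U; split=> // x _. Qed.

Lemma meager_in0 (T : topologicalType) (F : set T) : meager_in F set0.
Proof.
by exists (fun=> set0) => [n|x []//]; exact: nowhere_dense_in0.
Qed.

Lemma meager_in_nowhere_dense (T : topologicalType) (F N : set T) :
  nowhere_dense_in F N -> meager_in F N.
Proof. by move=> FN; exists (fun=> N) => // x [_ Nx]; exists 0%N. Qed.

Lemma meager_inS (T : topologicalType) (F A B : set T) :
  F `&` A `<=` B -> meager_in F B -> meager_in F A.
Proof.
move=> AB [E End FE]; exists E => // x FAx; apply: FE.
by split; [case: FAx | exact: AB].
Qed.

Lemma meager_in_bigcup (T : topologicalType) (F : set T) (K : countType)
    (A : K -> set T) :
  (forall k, meager_in F (A k)) -> meager_in F (\bigcup_k A k).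
Proof.
move=> H; have /choice[E HE] : forall k, exists E : nat -> set T,
    (forall n, nowhere_dense_in F (E n)) /\ F `&` A k `<=` \bigcup_n E n.
  by move=> k; have [E ? ?] := H k; exists E.
exists (fun q => if unpickle q is Some kn then E kn.1 kn.2 else set0).
  move=> q; case: unpickle => [[k n]|]; last exact: nowhere_dense_in0.
  by have [] := HE k.
move=> x [Fx [k _ Akx]]; have [_ /(_ x)[//|n _ En]] := HE k.
by exists (pickle (k, n)) => //; rewrite pickleK.
Qed.

Lemma meager_inU (T : topologicalType) (F A B : set T) :
  meager_in F A -> meager_in F B -> meager_in F (A `|` B).
Proof.
move=> mA mB.
apply: (@meager_inS _ _ _ (\bigcup_b (if b then A else B))).
  by move=> x [_ [|]]; [exists true | exists false].
by apply: meager_in_bigcup; case.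
Qed.

Lemma nowhere_dense_in_preimage (T T' : topologicalType) (F : set T)
    (F' : set T') (f : T -> T') (g : T' -> T) (N : set T') :
  (forall x, F x -> F' (f x)) -> (forall y, F' y -> F (g y)) ->
  (forall x, F x -> g (f x) = x) -> (forall y, F' y -> f (g y) = y) ->
  {within F, continuous f} -> {within F', continuous g} ->
  nowhere_dense_in F' N -> nowhere_dense_in F (f @^-1` N).
Proof.
move=> fF gF gf fg /continuous_withinP fc /continuous_withinP gc Nnd.
move=> U oU [x [Fx Ux]].
have [U' [oU' U'x U'U]] : exists W, [/\ open W, W (f x) & F' `&` W `<=` g @^-1` U].
  by apply: gc => //; [exact: fF | rewrite gf].
have [|V' [oV' V'U' [y [Fy V'y]] V'N]] := Nnd U' oU'.
  by exists (f x); split=> //; exact: fF.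
have [V [oV Vy VV']] : exists W, [/\ open W, W (g y) & F `&` W `<=` f @^-1` V'].
  by apply: fc => //; [exact: gF | rewrite fg].
exists (V `&` U); split=> //; first exact: openI.
  exists (g y); split; first exact: gF.
  by split=> //; apply: U'U; split=> //; exact: V'U'.
move=> z [Fz [Vz _]]; apply: V'N; split; first exact: fF.
exact: VV'.
Qed.

Lemma meager_in_preimage (T T' : topologicalType) (F : set T)
    (F' : set T') (f : T -> T') (g : T' -> T) (N : set T') :
  (forall x, F x -> F' (f x)) -> (forall y, F' y -> F (g y)) ->
  (forall x, F x -> g (f x) = x) -> (forall y, F' y -> f (g y) = y) ->
  {within F, continuous f} -> {within F', continuous g} ->
  meager_in F' N -> meager_in F (f @^-1` N).
Proof.
move=> fF gF gf fg fc gc [E End NE]; exists (fun n => f @^-1` E n).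
  by move=> n; exact: (nowhere_dense_in_preimage fF gF gf fg fc gc).
move=> x [Fx Nx]; have [|n _ En] := NE (f x); last by exists n.
by split=> //; exact: fF.
Qed.

Definition baire_property_in (T : topologicalType) (F D : set T) :=
  exists Q, [/\ open Q, meager_in F (D `\` Q) & meager_in F (Q `\` D)].

Lemma baire_property_in_open (T : topologicalType) (F U : set T) :
  open U -> baire_property_in F U.
Proof. by move=> oU; exists U; rewrite setDv; split=> //; exact: meager_in0. Qed.

Lemma eq_baire_property_in (T : topologicalType) (F D E : set T) :
  F `&` D = F `&` E -> baire_property_in F D -> baire_property_in F E.
Proof.
move=> /seteqP[DE ED] [Q [oQ mD mQ]]; have DEx x : F x -> D x <-> E x.
  by move=> Fx; split=> H; [have [] := DE x | have [] := ED x].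
exists Q; split=> //.
  by apply: meager_inS mD => x [Fx [/(DEx x Fx)]].
by apply: meager_inS mQ => x [Fx [Qx nE]]; split=> // /(DEx x Fx).
Qed.

Lemma baire_property_inC (T : topologicalType) (F D : set T) :
  baire_property_in F D -> baire_property_in F (~` D).
Proof.
move=> [Q [oQ mD mQ]].
(* [Q'] is the exterior of [Q] relative to [F]; what neither [Q] nor [Q'] covers is a boundary,
   hence nowhere dense in [F]. *)
pose Q' := \bigcup_(V in [set V | open V /\ F `&` V `<=` ~` Q]) V.
have nd : nowhere_dense_in F (~` Q `\` Q').
  move=> U oU [x [Fx Ux]].
  have [[y [[Fy Uy] Qy]]|nQ] := pselect ((F `&` U) `&` Q !=set0).
    exists (U `&` Q); split=> //; first exact: openI.
      by exists y.
    by move=> z [_ [_ Qz]] [].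
  exists U; split=> //; first by exists x.
  move=> z [Fz Uz] [_]; apply; exists U => //; split=> // w FUw Qw.
  by apply: nQ; exists w.
exists Q'; split; first by apply: bigcup_open => V [].
  apply: meager_inS (meager_inU mQ (meager_in_nowhere_dense nd)).
  move=> x [Fx [nD nQ']]; have [Qx|nQ] := pselect (Q x); first by left.
  by right.
apply: meager_inS mD => x [Fx [[V [oV VQ] Vx] /contrapT Dx]]; split=> //.
exact: (VQ x).
Qed.

Lemma baire_property_in_bigcup (T : topologicalType) (F : set T)
    (K : countType) (D : K -> set T) :
  (forall k, baire_property_in F (D k)) -> baire_property_in F (\bigcup_k D k).
Proof.
move=> /choice[Q QP]; exists (\bigcup_k Q k); split.
- by apply: bigcup_open => k _; have [] := QP k.
- apply: (@meager_inS _ _ _ (\bigcup_k (D k `\` Q k))).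
    by move=> x [_ [[k _ Dk] nQ]]; exists k => //; split=> // Ok; apply: nQ; exists k.
  by apply: meager_in_bigcup => k; have [] := QP k.
- apply: (@meager_inS _ _ _ (\bigcup_k (Q k `\` D k))).
    by move=> x [_ [[k _ Dk] nQ]]; exists k => //; split=> // Ok; apply: nQ; exists k.
  by apply: meager_in_bigcup => k; have [] := QP k.
Qed.

Lemma baire_property_inD (T : topologicalType) (F D E : set T) :
  baire_property_in F D -> baire_property_in F E ->
  baire_property_in F (D `\` E).
Proof.
move=> bD bE; rewrite -[D `\` E]setCK setDE setCI setCK.
apply: baire_property_inC; rewrite (_ : _ `|` _ = \bigcup_b (if b then ~` D else E)).
  apply: baire_property_in_bigcup; case=> //.
  exact: baire_property_inC.
apply/seteqP; split=> [x [|]|x [[] _ ?]]; [by exists true|by exists false|by left|by right].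
Qed.

(** * Spaces with convergent countable approximations *)

(* A positional, countable form of a winning strategy for the second player in
   the strong Choquet game on [S] whose plays are required to converge. *)
Definition choquet_approximation (T : topologicalType) (S : set T) (I : countType)
    (s0 : I) (B : I -> set T) (prec : I -> I -> Prop) :=
  [/\ forall i, open (B i), B s0 = setT, forall i j, prec i j -> B j `<=` B i,
      forall i x U, S x -> B i x -> open U -> U x ->
        exists j, [/\ prec i j, B j x & B j `<=` U]
    & forall u : nat -> I, (forall k, prec (u k) (u k.+1)) ->
        exists x, [/\ S x, forall k, B (u k) x
          & forall U, open U -> U x -> exists k, B (u k) `<=` U]].

Definition approximable (T : topologicalType) (S : set T) :=
  exists (I : countType) (s0 : I) (B : I -> set T) (prec : I -> I -> Prop),
    choquet_approximation S s0 B prec.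

Lemma chain_subset (T : Type) (A : nat -> set T) :
  (forall k, A k.+1 `<=` A k) -> forall k m, (k <= m)%N -> A m `<=` A k.
Proof.
move=> H k; elim=> [|m IH]; first by rewrite leqn0 => /eqP ->.
rewrite leq_eqVlt => /orP[/eqP -> //|]; rewrite ltnS => /IH.
exact: subset_trans (H m).
Qed.

(** The usual Baire argument: move [k] of a play started inside [U] avoids [E k], and the limit of
    the play lies in [S] and [U] but in no [E k]. *)
Lemma approximable_baire (T : topologicalType) (S U : set T) :
  approximable S -> open U -> S `&` U !=set0 -> ~ meager_in S U.
Proof.
move=> [I [s0 [B [prec [Bo Bs0 Bmono B1 B2]]]]] oU [x [Sx Ux]] [E End SUE].
have [n0 [_ n0x n0U]] : exists j, [/\ prec s0 j, B j x & B j `<=` U].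
  by apply: B1 => //; rewrite Bs0.
have /choice[g gP] : forall nk : I * nat, exists m, S `&` B nk.1 !=set0 ->
    [/\ prec nk.1 m, S `&` B m !=set0 & S `&` B m `<=` ~` E nk.2].
  move=> [n k] /=; have [SB|nSB] := pselect (S `&` B n !=set0); last by exists n.
  have [V [oV VB [y [Sy Vy]] VE]] := End k _ (Bo n) SB.
  have [m [nm my mV]] := B1 n y V Sy (VB _ Vy) oV Vy.
  exists m => _; split=> //; first by exists y.
  by move=> z [Sz mz]; apply: VE; split=> //; exact: mV.
pose v := fix v k := if k is k'.+1 then g (v k', k') else n0.
have vS k : S `&` B (v k) !=set0.
  elim: k => [|k IH]; first by exists x.
  by have [] := gP (v k, k) IH.
have [k|z [Sz vz _]] := B2 v; first by have [] := gP (v k, k) (vS k).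
have [k _ Ek] : (\bigcup_n E n) z by apply: SUE; split=> //; exact/n0U/(vz 0%N).
by have [_ _ /(_ z (conj Sz (vz k.+1)))] := gP (v k, k) (vS k).
Qed.

Lemma approximableX (T1 T2 : topologicalType) (S1 : set T1) (S2 : set T2) :
  approximable S1 -> approximable S2 -> approximable (S1 `*` S2).
Proof.
move=> [I [s [B [P [Bo Bs Bm B1 B2]]]]] [I' [s' [B' [P' [Bo' Bs' Bm' B1' B2']]]]].
exists (I * I')%type, (s, s'), (fun i => B i.1 `*` B' i.2).
exists (fun i j => P i.1 j.1 /\ P' i.2 j.2); split.
- by move=> [i i'] /=; exact: open_setX.
- by rewrite Bs Bs' setXTT.
- by move=> [i i'] [j j'] [/= /Bm H /Bm' H'] [x y] [/= /H ? /H' ?].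
- move=> [i i'] [x y] U [/= Sx Sy] [/= Bx By] oU Uxy.
  have [W [W' [oW oW' Wx W'y WU]]] := open_setX_base oU Uxy.
  have [j [ij jx jW]] := B1 i x W Sx Bx oW Wx.
  have [j' [ij' jy jW']] := B1' i' y W' Sy By oW' W'y.
  exists (j, j'); split=> // -[a b] [/= /jW ? /jW' ?]; exact: WU.
- move=> u uP; have [k|x [Sx xB xU]] := B2 (fun k => (u k).1).
    by have [] := uP k.
  have [k|y [Sy yB yU]] := B2' (fun k => (u k).2); first by have [] := uP k.
  exists (x, y); split=> // U oU Uxy.
  have [W [W' [oW oW' Wx W'y WU]]] := open_setX_base oU Uxy.
  have [k kW] := xU W oW Wx; have [k' kW'] := yU W' oW' W'y.
  exists (maxn k k') => -[a b] [/= Ba Bb]; apply: WU; split=> /=.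
    apply/kW/(@chain_subset _ (fun k => B (u k).1) _ k (maxn k k')) => //.
      by move=> m; apply: Bm; have [] := uP m.
    exact: leq_maxl.
  apply/kW'/(@chain_subset _ (fun k => B' (u k).2) _ k' (maxn k k')) => //.
    by move=> m; apply: Bm'; have [] := uP m.
  exact: leq_maxr.
Qed.

(* The subsets of [S] cut out here are the Pi^0_2 subsets in the sense suited to
   non-metrizable spaces. *)
Lemma approximable_implications (T : topologicalType) (S : set T)
    (J : countType) (U V : J -> set T) :
  approximable S -> (forall j, open (U j)) -> (forall j, open (V j)) ->
  approximable (S `&` [set x | forall j, U j x -> V j x]).
Proof.
move=> [I [s [B [P [Bo Bs Bm B1 B2]]]]] Uo Vo.
(* The second component is a counter. At value [k] a move enforces the implications of code below
   [k] whose premise contains the current set. These are finitely many, so a neighbourhood suffices,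
   and each implication is reached in the end. *)
exists (I * nat)%type, (s, 0%N), (fun i => B i.1).
exists (fun i j => [/\ P i.1 j.1, j.2 = i.2.+1
  & forall a, (pickle a < i.2)%N -> B i.1 `<=` U a -> B j.1 `<=` V a]); split.
- by move=> [].
- by [].
- by move=> i j [/Bm].
- move=> [n k] x W [Sx xUV] /= Bx oW Wx.
  have : nbhs x (W `&` [set y | forall a, (pickle a < k)%N ->
      B n `<=` U a -> V a y]).
    apply: filterI; first exact: open_nbhs_nbhs.
    apply: filter_forall_pickle => a.
    have [nU|nU] := pselect (B n `<=` U a); last first.
      by apply: filterS filterT => y _ /nU.
    apply: filterS (open_nbhs_nbhs (conj (Vo a) _)); last exact/xUV/nU.
    by move=> y Vy _.
  rewrite nbhsE => -[W' [oW' W'x] W'W].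
  have [m [nm mx mW]] := B1 n x W' Sx Bx oW' W'x.
  exists (m, k.+1); split=> //=; last by move=> y /mW/W'W[].
  by split=> // a ak nU y /mW/W'W[_]; exact.
- move=> u uP; have [k|x [Sx xB xU]] := B2 (fun k => (u k).1).
    by have [] := uP k.
  exists x; split=> //; split=> // a /(xU _ (Uo a))[k kU].
  have uk m : (u m).2 = ((u 0%N).2 + m)%N.
    elim: m => [|m IH]; first by rewrite addn0.
    by have [_ -> _] := uP m; rewrite IH addnS.
  pose m := maxn k (pickle a).+1.
  have [_ _ /(_ a)] := uP m; apply; last exact: (xB m.+1).
    by rewrite uk (leq_trans _ (leq_addl _ _)) // leq_maxr.
  move=> y Hy; apply: kU.
  apply: (@chain_subset _ (fun k => B (u k).1) _ k m) => //.
    by move=> q; apply: Bm; have [] := uP q.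
  exact: leq_maxl.
Qed.

(** * Quasi-metrics *)

Section QuasiMetric.
Local Open Scope ring_scope.

Lemma exists_invS_lt (R : realType) (e : R) :
  0 < e -> exists n : nat, n.+1%:R^-1 < e.
Proof. by move=> /ltr_add_invr[n]; rewrite add0r; exists n. Qed.

Lemma lt_invS (R : realType) (m n : nat) :
  (m.+1%:R^-1 < n.+1%:R^-1 :> R) = (n < m)%N.
Proof. by rewrite ltf_pV2 ?posrE ?ltr0n // ltr_nat ltnS. Qed.

Lemma le_invS (R : realType) (m n : nat) :
  (m.+1%:R^-1 <= n.+1%:R^-1 :> R) = (n <= m)%N.
Proof. by rewrite lef_pV2 ?posrE ?ltr0n // ler_nat ltnS. Qed.

Lemma quasi_metric_ball_open (R : realType) (T : topologicalType)
    (d : T -> T -> R) :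
  (forall x y z, d x z <= d x y + d y z) -> @open T = quasi_metric_open d ->
  forall x e, open [set y | d x y < e].
Proof.
move=> dtri od x e; rewrite od => y /= xy; exists (e - d x y).
  by rewrite subr_gt0.
by move=> z /= yz; have := dtri x y z; lra.
Qed.

Lemma quasi_polish_kolmogorov (R : realType) (T : topologicalType) :
  quasi_polish R T -> kolmogorov_space T.
Proof.
move=> [_ [d [[d0 dE dtri] od _]]]; apply/kolmogorovP => x y xy.
have ball_open := quasi_metric_ball_open dtri od.
have dz z t : (forall U, open U -> U z -> U t) -> d z t = 0.
  move=> H; apply/eqP; rewrite eq_le d0 andbT leNgt; apply/negP => zt.
  have /= := H _ (ball_open z (d z t)); rewrite ltxx.
  by have [/(_ erefl)[-> _] _] := dE z z => /(_ zt).
by apply/dE; split; apply: dz => U oU /(xy U oU).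
Qed.

Lemma quasi_polish_approximable (R : realType) (T : topologicalType) :
  quasi_polish R T -> approximable [set: T].
Proof.
move=> [/second_countableP[b [bo bn]] [d [[d0 dE dtri] od dc]]].
have dxx z : d z z = 0 by have [/(_ erefl)[]] := dE z z.
have ball_open := quasi_metric_ball_open dtri od.
have open_ball U x : open U -> U x -> exists2 e, 0 < e & [set t | d x t < e] `<=` U.
  by rewrite od => /[apply].
(* [None] codes the whole space, the starting position; the second component sets the radius
   [r s]. *)
pose B (s : option nat * nat) := if s.1 is Some n then b n else setT.
pose r (s : option nat * nat) : R := s.2.+1%:R^-1.
have r0 s : 0 < r s by rewrite invr_gt0.
exists (option nat * nat)%type, (None, 0%N), B.
(* Along a chain the radii tend to 0 and the centres [z] are Cauchy. Their limit lies less than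
   [r t + r t] away from each centre, which is why the ball of doubled radius has to fit in
   [B s]. *)
exists (fun s t => [/\ (s.2 < t.2)%N, B t `<=` B s & exists z,
  [/\ B t z, B t `<=` [set y | d z y < r t]
    & [set y | d z y < r t + r t] `<=` B s]]); split=> //.
- by move=> [[n|] k]; [exact: bo | exact: openT].
- by move=> s t [].
- move=> s x U _ Bx oU Ux.
  have Bo : open (B s) by rewrite /B; case: (s.1) => [n|]; [exact: bo|exact: openT].
  have [e e0 eU] := open_ball _ _ (openI oU Bo) (conj Ux Bx).
  have [|k ke] := @exists_invS_lt R (e / 3); first by lra.
  pose q := maxn k s.2.+1.
  have rq : q.+1%:R^-1 < e / 3 by apply: le_lt_trans ke; rewrite le_invS leq_maxl.
  have q0 : 0 < q.+1%:R^-1 :> R by rewrite invr_gt0.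
  have q1 : q.+1%:R^-1 < e by move: q0 rq; set w := _^-1 => *; lra.
  have q2 : q.+1%:R^-1 + q.+1%:R^-1 < e by move: q0 rq; set w := _^-1 => *; lra.
  have [|n nx nb] := bn x _ (ball_open x q.+1%:R^-1); first by rewrite /= dxx.
  have nUB : b n `<=` U `&` B s.
    by apply: subset_trans nb _ => y /= dy; apply: eU; exact: lt_trans q1.
  exists (Some n, q); split=> //=; last by move=> y /nUB[].
  split; [exact: leq_maxr | by move=> y /nUB[] |].
  exists x; split=> // y /= dy.
  by have [|] := eU y; first exact: lt_trans q2.
- move=> u uP; have /choice[z zP] k := (let: And3 _ _ H := uP k in H).
  have Bsub : forall k m, (k <= m)%N -> B (u m) `<=` B (u k).
    by apply: chain_subset => k; have [] := uP k.
  have lvl k : (k <= (u k).2)%N.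
    by elim: k => // k IH; have [H _ _] := uP k; apply: leq_ltn_trans H.
  have zd k m : (k <= m)%N -> d (z k) (z m) < r (u k.+1).
    move=> km; have [_ + _] := zP k; apply; apply: (@Bsub k.+1 m.+1) => //.
    by have [] := zP m.
  have rk k : r (u k.+1) <= k.+1%:R^-1.
    by rewrite le_invS; apply: leq_trans (lvl k.+1).
  have [e e0|l lP] := dc z.
    have [N Ne] := exists_invS_lt e0; exists N => n m Nn nm.
    apply: lt_trans (zd n m nm) _; apply: le_lt_trans (rk n) _.
    by apply: le_lt_trans Ne; rewrite le_invS.
  exists l; split=> // [k|U oU Ul].
    have [N /(_ (maxn N k))] := lP _ (r0 (u k.+1)).
    rewrite leq_maxl gt_max => /(_ isT) /andP[dl _].
    have [_ _] := zP k; apply => /=.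
    apply: le_lt_trans (dtri _ (z (maxn N k)) _) _.
    by apply: ltrD => //; apply: zd; rewrite leq_maxr.
  have [e e0 eU] := open_ball U l oU Ul.
  have e20 : 0 < e / 2 by lra.
  have [N /(_ _)NP] := lP _ e20; have [k ke] := exists_invS_lt e20.
  have := NP (maxn N k); rewrite leq_maxl gt_max => /(_ isT) /andP[_ dl].
  exists (maxn N k).+1 => y; have [_ zy _] := zP (maxn N k) => /zy /= dy.
  apply: eU => /=; apply: le_lt_trans (dtri _ (z (maxn N k)) _) _.
  suff : r (u (maxn N k).+1) < e / 2 by lra.
  apply: le_lt_trans (rk _) _; apply: le_lt_trans ke.
  by rewrite le_invS leq_maxr.
Qed.

(** Take [d x y] to be the inverse of [m.+1] for the least code [m] of a preorder that fails from
    [x] to [y], and 0 if none fails. Transitivity of the preorders yields the triangle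
    inequality. *)
Lemma quasi_metric_of_preorders (R : realType) (T : Type) (K : countType)
    (P : K -> T -> T -> Prop) :
  (forall k x, P k x x) -> (forall k x y z, P k x y -> P k y z -> P k x z) ->
  exists d : T -> T -> R,
    [/\ forall x y, 0 <= d x y, forall x y z, d x z <= d x y + d y z
      & forall x y n, d x y < n.+1%:R^-1 <->
          forall k, (pickle k <= n)%N -> P k x y].
Proof.
move=> Prefl Ptrans.
pose bad x y n := exists2 k, pickle k = n & ~ P k x y.
have /choice[d dP] : forall xy : T * T, exists e : R,
    [/\ 0 <= e, e = 0 \/ exists m : nat, e = m.+1%:R^-1
      & forall n, e < n.+1%:R^-1 <->
          forall k, (pickle k <= n)%N -> P k xy.1 xy.2].
  move=> [x y] /=; have [[n0 badn0]|nbad] := pselect (exists n, bad x y n).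
    have ex : exists n, `[<bad x y n>] by exists n0; apply/asboolP.
    case: (ex_minnP ex) => m /asboolP[k km nP] mmin.
    exists m.+1%:R^-1; split; first by rewrite invr_ge0.
      by right; exists m.
    move=> n; rewrite lt_invS; split=> [nm k' k'n|H].
      apply: contrapT => nP'; have : (m <= pickle k')%N.
        by apply: mmin; apply/asboolP; exists k'.
      by rewrite leqNgt (leq_ltn_trans k'n nm).
    rewrite ltnNge; apply/negP => mn; apply: nP; apply: H.
    by rewrite km.
  exists 0; split=> //; first by left.
  move=> n; split=> [_ k _|_]; last by rewrite invr_gt0.
  by apply: contrapT => nP; apply: nbad; exists (pickle k), k.
exists (fun x y => d (x, y)); split=> [x y|x y z|x y n]; last 1 first.
- by have [] := dP (x, y).
- by have [] := dP (x, y).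
have [dxy0 _ dxy] := dP (x, y); have [dyz0 _ dyz] := dP (y, z).
have [_ [->|[m dm]] dxz] := dP (x, z); first exact: addr_ge0.
rewrite leNgt; apply/negP => lt.
have : d (x, z) < m.+1%:R^-1; last by rewrite dm ltxx.
apply/dxz => k km; apply: (Ptrans _ _ y).
  by move: k km; apply/dxy; rewrite -dm; apply: le_lt_trans lt; rewrite lerDl.
by move: k km; apply/dyz; rewrite -dm; apply: le_lt_trans lt; rewrite lerDr.
Qed.

(** For the quasi-metric of [quasi_metric_of_preorders], a ball of radius the inverse of [n.+1] is a
    finite intersection of sets [P k x]; openness, Cauchy sequences and limits can thus be checked
    one preorder at a time. *)
Lemma quasi_polish_of_preorders (R : realType) (T : topologicalType)
    (K : countType) (P : K -> T -> T -> Prop) :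
  @second_countable T -> kolmogorov_space T ->
  (forall k x, P k x x) -> (forall k x y z, P k x y -> P k y z -> P k x z) ->
  (forall k x, nbhs x (P k x)) ->
  (forall x U, open U -> U x -> exists k, P k x `<=` U) ->
  (forall u : nat -> T,
    (forall k, exists N, forall n m, (N <= n)%N -> (n <= m)%N ->
       P k (u n) (u m)) ->
    exists l, forall k, \forall n \near \oo, P k (u n) l /\ P k l (u n)) ->
  quasi_polish R T.
Proof.
move=> sc /kolmogorovP T0 Prefl Ptrans Pnbhs Pbase Pcomplete; split=> //.
have [d [d0 dtri dP]] := quasi_metric_of_preorders R Prefl Ptrans.
have dP0 x y : d x y = 0 -> forall k, P k x y.
  move=> dxy k; have [+ _] := dP x y (pickle k); apply=> //.
  by rewrite dxy invr_gt0.
have dxx x : d x x = 0.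
  apply/eqP; rewrite eq_le d0 andbT leNgt; apply/negP => /exists_invS_lt[n].
  have [_ H] := dP x x n; have /H : forall k, (pickle k <= n)%N -> P k x x by [].
  by move=> /lt_trans/[apply]; rewrite ltxx.
exists d; split.
- split=> // x y; split=> [->|[/dP0 xy /dP0 yx]]; first by rewrite dxx.
  by apply: T0 => U oU; split=> /Pbase -/(_ oU)[k kU]; exact: kU.
- apply/seteqP; split=> U.
    move=> oU x /Pbase -/(_ oU)[k kU]; exists (pickle k).+1%:R^-1.
      by rewrite invr_gt0.
    by move=> y /dP/(_ k (leqnn _)); exact: kU.
  move=> dU; rewrite openE => x /dU[e /exists_invS_lt[n ne] eU].
  have := @filter_forall_pickle _ _ _ (P^~ x) n.+1 (nbhs_filter x) (Pnbhs^~ x).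
  apply: filterS => y yP; apply: eU => /=; apply: lt_trans ne.
  by apply/dP => k; rewrite -ltnS; exact: yP.
- move=> u uC; have [k|l lP] := Pcomplete u.
    have [|N NP] := uC (pickle k).+1%:R^-1; first by rewrite invr_gt0.
    by exists N => n m Nn nm; have /dP := NP n m Nn nm; exact.
  exists l => e /exists_invS_lt[q qe].
  have [N _ NP] := @filter_forall_pickle _ _ _ _ q.+1 _ lP.
  exists N => n /NP /= nP; rewrite gt_max.
  by rewrite !(lt_trans _ qe) //; apply/dP => k; rewrite -ltnS => /nP[].
Qed.

End QuasiMetric.

(** * Open images of approximable spaces *)

Section OpenImage.
Variables (T Y : topologicalType) (S : set T) (f : T -> Y).
Hypothesis f_cont : forall x V, S x -> open V -> V (f x) ->
  exists U, [/\ open U, U x & S `&` U `<=` f @^-1` V].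
Hypothesis f_open : forall U, open U -> open (f @` (S `&` U)).
Hypothesis f_onto : forall y, exists2 x, S x & f x = y.
Variables (I : countType) (s0 : I) (B : I -> set T) (prec : I -> I -> Prop).
Hypothesis apx : choquet_approximation S s0 B prec.
Variables (J : countType) (c : J -> set Y) (c_base : indexed_base c).

Let Q i := f @` (S `&` B i).
Let C (i : I + J) := match i with inl i => Q i | inr j => c j end.

(* [W n i j] increases with [j] to [Q n `&` C i]. Controlling the least [j]
   with [x] in [W n i j], and not just membership in the union, is what forces
   Cauchy sequences to converge. *)
Let W n i j := \bigcup_(m in [set m |
  [/\ (pickle m <= j)%N, prec n m & Q m `<=` C i]]) Q m.

(** The preorders that will define the quasi-metric. The case [inr] says that the least [j] with
    [W n i j] does not increase from [x] to [y]. *)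
Let P (k : (I + J) + I * (I + J)) (x y : Y) :=
  match k with
  | inl i => C i x -> C i y
  | inr (n, i) => forall j, W n i j x -> W n i j y
  end.

Let oQ i : open (Q i).
Proof. by apply: f_open; have [] := apx. Qed.

Let oC i : open (C i).
Proof. by case: i => [i|j]; [exact: oQ | exact: (proj1 c_base)]. Qed.

Let oW n i j : open (W n i j).
Proof. by apply: bigcup_open => m _; exact: oQ. Qed.

Let W_mono n i j j' : (j <= j')%N -> W n i j `<=` W n i j'.
Proof.
by move=> jj' x [m [mj nm QC] Qx]; exists m => //; split=> //; exact: leq_trans jj'.
Qed.

Let Q_refine n i y : Q n y -> C i y ->
  exists m, [/\ prec n m, Q m y & Q m `<=` C i].
Proof.
move=> [x [Sx Bx] <-] Cx; have [U [oU Ux SU]] := f_cont Sx (oC i) Cx.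
have [_ _ _ + _] := apx => /(_ n x U Sx Bx oU Ux)[m [nm mx mU]].
exists m; split=> //; first by exists x.
by move=> _ [z [Sz mz] <-]; apply: SU; split=> //; exact: mU.
Qed.

Let Q0 y : Q s0 y.
Proof.
by have [x Sx <-] := f_onto y; exists x => //; split=> //; have [_ ->] := apx.
Qed.

(** For [inr], the open set [W n i j] with [j] least for [x] serves all the implications at once,
    because [W] increases with its last index. *)
Let P_nbhs k x : nbhs x (P k x).
Proof.
case: k => [i|[n i]] /=.
  have [Cx|nCx] := pselect (C i x); last by apply: filterS filterT => y _ /nCx.
  by apply: filterS (open_nbhs_nbhs (conj (oC i) Cx)) => y Cy _.
have [[j0 Wj0]|nW] := pselect (exists j, W n i j x); last first.
  by apply: filterS filterT => y _ j Wj; case: nW; exists j.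
have ex : exists j, `[<W n i j x>] by exists j0; apply/asboolP.
case: (ex_minnP ex) => j /asboolP Wj jmin.
apply: filterS (open_nbhs_nbhs (conj (oW n i j) Wj)) => y Wy j' /asboolP /jmin.
by move/W_mono; exact.
Qed.

Section Complete.
Variable u : nat -> Y.
Hypothesis u_cauchy : forall k, exists N, forall n m,
  (N <= n)%N -> (n <= m)%N -> P k (u n) (u m).

Local Notation ev D := (\forall n \near \oo, (D : set Y) (u n)).

Let evP D : ev D <-> exists N, forall n, (N <= n)%N -> D (u n).
Proof. by split=> [[N _ NP]|[N NP]]; exists N. Qed.

(** Past the Cauchy bound for [inl i], membership in [C i] is never lost once gained. *)
Let ev_dichotomy i : ev (C i) \/ ev (~` C i).
Proof.
have [N NP] := u_cauchy (inl i).
have [[n Nn Cn]|nC] := pselect (exists2 n, (N <= n)%N & C i (u n)).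
  left; exists n => // m nm; exact: (NP n m).
by right; exists N => // m Nm Cm; apply: nC; exists m.
Qed.

Let ev_incompat D : ev D -> ev (~` D) -> False.
Proof.
move=> D1 D2; have : ev (D `&` ~` D) by apply: filterI.
by move=> [N _ /(_ N (leqnn _))[]].
Qed.

(** A pigeonhole: finitely many [m] have code at most [j], and by [ev_dichotomy] the sequence ends
    up inside or outside each [Q m]; it cannot leave all those making up [W n i j]. *)
Let ev_W n i j : ev (W n i j) ->
  exists m, [/\ prec n m, Q m `<=` C i, (pickle m <= j)%N & ev (Q m)].
Proof.
move=> evW; apply: contrapT => nm; apply: (ev_incompat evW).
have H (m : I) : \forall k \near \oo, prec n m -> Q m `<=` C i ->
    (pickle m <= j)%N -> ~ Q m (u k).
  have [[nm' QC mj]|nH] :=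
      pselect [/\ prec n m, Q m `<=` C i & (pickle m <= j)%N]; last first.
    by apply: filterS filterT => k _ ? ? ?; case: nH.
  have [evm|evnm] := ev_dichotomy (inl m).
    by case: nm; exists m.
  by apply: filterS evnm => k nQ _ _ _.
apply: filterS (@filter_forall_pickle _ _ _ _ j.+1 _ H).
by move=> k kP [m [mj nm' QC] Qm]; exact: (kP m).
Qed.

(** A refinement [m] found at one late term [u N] bounds, through the preorder [inr (n, i)], the
    codes needed at all later terms; [ev_W] then gives a single refinement good for the whole
    tail. *)
Let ev_refine n i : ev (Q n) -> ev (C i) ->
  exists m, [/\ prec n m, ev (Q m) & Q m `<=` C i].
Proof.
move=> /evP[N1 N1P] /evP[N2 N2P]; have [N3 N3P] := u_cauchy (inr (n, i)).
pose N := maxn N1 (maxn N2 N3).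
have N1N : (N1 <= N)%N by rewrite leq_maxl.
have N2N : (N2 <= N)%N by rewrite /N maxnCA leq_maxl.
have N3N : (N3 <= N)%N by rewrite /N maxnA leq_maxr.
have [m [nm mN QC]] := Q_refine (N1P N N1N) (N2P N N2N).
have /ev_W[m' [? ? _ ?]] : ev (W n i (pickle m)); last by exists m'.
by exists N => // k Nk; apply: (N3P N k N3N Nk); exists m.
Qed.

Lemma open_image_limit :
  exists l, forall k, \forall n \near \oo, P k (u n) l /\ P k l (u n).
Proof.
have ev0 : ev (C (inl s0)) by apply: filterS filterT => n _; exact: Q0.
(* Move [k] also enters the open set of code [k] if the sequence ends up there, so the limit of the
   play belongs to all such sets. The default target is [inl s0], whose set is all of [Y]. *)
have /choice[g gP] : forall nk : I * nat, exists m, ev (Q nk.1) ->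
    [/\ prec nk.1 m, ev (Q m)
      & forall i, unpickle nk.2 = Some i -> ev (C i) -> Q m `<=` C i].
  move=> [n k] /=; have [evn|nevn] := pselect (ev (Q n)); last by exists n.
  pose i := if unpickle k is Some i then
    (if pselect (ev (C i)) then i else inl s0) else inl s0.
  have evi : ev (C i) by rewrite /i; case: unpickle => // a; case: pselect.
  have [m [nm evm QC]] := ev_refine evn evi.
  exists m => _; split=> // a ka eva; apply: subset_trans QC _.
  by rewrite /i ka; case: pselect => [_ y|nev] //; case: (nev eva).
pose v := fix v k := if k is k'.+1 then g (v k', k') else s0.
have v_ev k : ev (Q (v k)) by elim: k => // k /(gP (v k, k))[].
have [_ _ _ _ /(_ v)[k|x [Sx vx xU]]] := apx; first by have [] := gP (v k, k) (v_ev k).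
exists (f x).
have CP i : C i (f x) <-> ev (C i).
  split=> [Cfx|evi].
    have [U [oU Ux SU]] := f_cont Sx (oC i) Cfx; have [k kU] := xU U oU Ux.
    apply: filterS (v_ev k) => n [z [Sz Bz] <-]; apply: SU; split=> //; exact: kU.
  have [_ _ /(_ i)] := gP (v (pickle i), pickle i) (v_ev _).
  by rewrite pickleK => /(_ erefl evi); apply; exists x => //; split=> //;
    exact: (vx (pickle i).+1).
have WP n i j : W n i j (f x) <-> ev (W n i j).
  split=> [[m mP /(CP (inl m)) evm]|/ev_W[m [nm QC mj /(CP (inl m)) Qm]]].
    by apply: filterS evm => k Qm; exists m.
  by exists m.
move=> [i|[n i]] /=.
  have [evi|evni] := ev_dichotomy i.
    by have Cfx := (CP i).2 evi; apply: filterS evi => k Ck.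
  have nCfx : ~ C i (f x) by move=> /CP /ev_incompat; exact.
  by apply: filterS evni.
have [N NP] := u_cauchy (inr (n, i)).
apply: filterI.
  exists N => // k /= Nk j Wj; apply/WP; exists k => // m km.
  exact: (NP k m).
have [[j0 Wj0]|nW] := pselect (exists j, W n i j (f x)); last first.
  by apply: filterS filterT => k _ j Wj; case: nW; exists j.
have ex : exists j, `[<W n i j (f x)>] by exists j0; apply/asboolP.
case: (ex_minnP ex) => j /asboolP /WP Wj jmin.
apply: filterS Wj => k Wk j' /asboolP /jmin jj'; exact: W_mono Wk.
Qed.

End Complete.

Lemma open_image_quasi_polish (R : realType) :
  kolmogorov_space Y -> quasi_polish R Y.
Proof.
move=> T0; apply: (@quasi_polish_of_preorders R Y _ P) => //.
- exact: second_countable_base c_base.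
- by case=> [i|[n i]] x.
- case=> [i|[n i]] x y z /= xy yz; first by move/xy/yz.
  by move=> j /xy/yz.
- move=> x U oU Ux; have [_ /(_ x U oU Ux)[i ix iU]] := c_base.
  by exists (inl (inr i)) => y /= /(_ ix)/iU.
- exact: open_image_limit.
Qed.

End OpenImage.

(** * Groupoid actions *)

Lemma inv_inv (G0 G : Type) (C : groupoid G0 G) g : inv C (inv C g) = g.
Proof.
rewrite -[LHS](mul_idmr C) src_inv tgt_inv -(mul_invl C g).
rewrite mul_assoc ?src_inv ?tgt_inv // mul_invl src_inv.
exact: mul_idml.
Qed.

Lemma inv_idm (G0 G : Type) (C : groupoid G0 G) x :
  inv C (idm C x) = idm C x.
Proof. by rewrite -{1}(mul_idmr C (inv C _)) src_inv tgt_idm mul_invl src_idm. Qed.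

Section ActionAlgebra.
Variables (G0 G X : Type) (C : groupoid G0 G) (p : X -> G0).
Variable alpha : groupoid_action C p.

Lemma act_invK g a : src C g = p a -> alpha (inv C g) (alpha g a) = a.
Proof.
move=> ga; rewrite -act_mul ?src_inv // mul_invl ga.
exact: act_idm.
Qed.

Lemma act_Kinv g a : tgt C g = p a -> alpha g (alpha (inv C g) a) = a.
Proof. by move=> ga; rewrite -{1}(inv_inv C g) act_invK // src_inv. Qed.

Lemma act_inv_proj g a : tgt C g = p a -> p (alpha (inv C g) a) = src C g.
Proof. by move=> ga; rewrite act_proj ?tgt_inv // src_inv. Qed.

Lemma translateE g A a : tgt C g = p a ->
  translate alpha g A a <-> A (alpha (inv C g) a).
Proof.
move=> ga; split=> [[b [Ab /= gb] <-]|Aa]; first by rewrite act_invK.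
exists (alpha (inv C g) a); last exact: act_Kinv.
by split=> //=; rewrite act_inv_proj.
Qed.

Lemma mul_invlK g k : src C g = tgt C k -> mul C (inv C g) (mul C g k) = k.
Proof.
move=> gk; rewrite mul_assoc ?src_inv // mul_invl gk; exact: mul_idml.
Qed.

Lemma mul_invrK g k : tgt C g = tgt C k -> mul C g (mul C (inv C g) k) = k.
Proof. by move=> gk; rewrite -{1}(inv_inv C g) mul_invlK // src_inv. Qed.

Lemma act_inv_mul g k a : src C g = p a -> tgt C k = p a ->
  alpha (inv C (mul C g k)) (alpha g a) = alpha (inv C k) a.
Proof.
move=> ga ka; have gk : src C g = tgt C k by rewrite ka.
rewrite -{1}(act_Kinv ka) -[alpha g _]act_mul ?act_inv_proj // act_invK //.
by rewrite src_mul // act_inv_proj.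
Qed.

End ActionAlgebra.

(** * Vaught transforms *)

Definition target_fiber (G0 G : Type) (C : groupoid G0 G) (x : G0) : set G :=
  tgt C @^-1` [set x].

Definition mul_subset (G0 G : Type) (C : groupoid G0 G) (V W U : set G) :=
  forall g h, V g -> W h -> src C g = tgt C h -> U (mul C g h).

Section Vaught.
Variables (G0 G : topologicalType) (X : Type) (C : groupoid G0 G).
Variables (p : X -> G0) (alpha : groupoid_action C p).
Hypothesis mul_cont :
  {within composable C, continuous (fun gh : G * G => mul C gh.1 gh.2)}.
Variables (b : nat -> set G) (b_base : indexed_base b).

Lemma vaughtE U A a : vaught alpha U A a <->
  ~ meager_in (target_fiber C (p a)) (U `&` [set g | A (alpha (inv C g) a)]).
Proof.
have mP := @meager_inP _ (target_fiber C (p a))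
  (fun g => U g /\ translate alpha g A a).
split=> nm m; apply: nm; first apply/mP; last move/mP: m => m;
  by apply: meager_inS m => g [ga [Ug]]; move/(translateE _ _ ga).
Qed.

Lemma vaughtS U U' A A' : U `<=` U' -> A `<=` A' ->
  vaught alpha U A `<=` vaught alpha U' A'.
Proof.
move=> UU' AA' a /vaughtE nm; apply/vaughtE => m; apply: nm.
by apply: meager_inS m => g [_ [/UU' ? /AA' ?]].
Qed.

Lemma vaught_nonempty U A a : vaught alpha U A a ->
  exists g, [/\ U g, tgt C g = p a & A (alpha (inv C g) a)].
Proof.
move=> /vaughtE nm; apply: contrapT => ng; apply: nm.
apply: meager_inS (meager_in0 _) => g [ga [Ug Ag]]; apply: ng.
by exists g.
Qed.

Lemma mul_open g h U : src C g = tgt C h -> open U -> U (mul C g h) ->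
  exists V W, [/\ open V, open W, V g, W h & mul_subset C V W U].
Proof.
move=> gh oU Ugh; have /continuous_withinP mc := mul_cont.
have [N1 [oN N1gh N1U]] := mc (g, h) U gh oU Ugh.
have [V [W [oV oW Vg Wh VW]]] := open_setX_base oN N1gh.
exists V, W; split=> // g' h' Vg' Wh' gh'.
by apply: (N1U (g', h')); split=> //; exact: VW.
Qed.

Lemma left_mul_cont g : {within target_fiber C (src C g), continuous (mul C g)}.
Proof.
apply/continuous_withinP => h U gh oU Ugh.
have [|V [W [oV oW Vg Wh VW]]] := mul_open _ oU Ugh; first by rewrite gh.
by exists W; split=> // h' [gh' Wh']; apply: VW; rewrite ?gh'.
Qed.

(** Left multiplication by [g] is a homeomorphism from the fiber over [p a] onto the fiber over
    [tgt C g], with inverse the multiplication by [inv C g]; it therefore preserves meagerness. *)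
Lemma vaught_act_translate g a U A : src C g = p a ->
  vaught alpha U A (alpha g a) <->
  ~ meager_in (target_fiber C (p a))
      [set k | U (mul C g k) /\ A (alpha (inv C k) a)].
Proof.
move=> ga; rewrite vaughtE act_proj //.
have gi : src C (inv C g) = tgt C g by rewrite src_inv.
have ig : tgt C (inv C g) = src C g by rewrite tgt_inv.
have F1 k : target_fiber C (p a) k -> target_fiber C (tgt C g) (mul C g k).
  by move=> /= ka; rewrite /target_fiber /= tgt_mul // ka.
have F2 h : target_fiber C (tgt C g) h ->
    target_fiber C (p a) (mul C (inv C g) h).
  by move=> /= ha; rewrite /target_fiber /= tgt_mul // ?ig // ha.
have K1 k : target_fiber C (p a) k -> mul C (inv C g) (mul C g k) = k.
  by move=> /= ka; rewrite mul_invlK // ka.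
have K2 h : target_fiber C (tgt C g) h -> mul C g (mul C (inv C g) h) = h.
  by move=> /= ha; rewrite mul_invrK // ha.
have c1 : {within target_fiber C (p a), continuous (mul C g)}.
  by rewrite -ga; exact: left_mul_cont.
have c2 : {within target_fiber C (tgt C g), continuous (mul C (inv C g))}.
  by rewrite -gi; exact: left_mul_cont.
split=> nm m; apply: nm.
  apply: meager_inS (meager_in_preimage F2 F1 K2 K1 c2 c1 m) => h [ha [Uh Ah]] /=.
  rewrite K2 //; split=> //.
  by rewrite -(act_inv_mul alpha ga) ?K2 //; exact: F2.
apply: meager_inS (meager_in_preimage F1 F2 K1 K2 c1 c2 m) => k [ka [Uk Ak]] /=.
by split=> //; rewrite /= act_inv_mul.
Qed.

(* No topology on [X] is involved: all continuity comes from that of the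
   multiplication of [G], and the countable base turns "covered by such [W]"
   into "nonmeager in one of them". *)
Lemma vaught_actP g a U A : open U -> src C g = p a ->
  vaught alpha U A (alpha g a) <->
  exists V W, [/\ open V, open W, V g, mul_subset C V W U & vaught alpha W A a].
Proof.
move=> oU ga; rewrite vaught_act_translate //; split=> [nm|]; last first.
  move=> [V [W [oV oW Vg VW /vaughtE nm]]] m; apply: nm.
  by apply: meager_inS m => k [ka [Wk Ak]]; split=> //; apply: VW; rewrite ?ga ?ka.
apply: contrapT => nVW; apply: nm.
pose good n := exists2 V, open V & V g /\ mul_subset C V (b n) U.
apply: (@meager_inS _ _ _ (\bigcup_n
    [set k | good n /\ (b n `&` [set k | A (alpha (inv C k) a)]) k])).
  move=> k [ka [Uk Ak]]; have [|V [W [oV oW Vg Wk VW]]] := mul_open _ oU Uk.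
    by rewrite ga ka.
  have [_ /(_ k W oW Wk)[n bnk bnW]] := b_base.
  exists n => //; split=> //; exists V => //; split=> // g' h' Vg' /bnW Wh'.
  exact: VW.
apply: meager_in_bigcup => n.
have [[V oV [Vg Vb]]|ngood] := pselect (good n); last first.
  by apply: meager_inS (meager_in0 _) => k [_ [/ngood]].
apply: contrapT => nm; apply: nVW; exists V, (b n); split=> //.
  by have [] := b_base.
by apply/vaughtE => m; apply: nm; apply: meager_inS m => k [_ []].
Qed.

Lemma vaught_unions_smallest (S : set (set X)) :
  vaught_unions alpha S `<=` smallest (@is_topology X) (vaught_sets alpha S).
Proof.
move=> V [F [_ FS ->]] N1 [[_ _ N1U] SO]; apply: N1U => W /FS; exact: SO.
Qed.

End Vaught.

(** The sets [V] at which the action is continuous form a topology, so generators suffice, and for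
    [U * A] the criterion [vaught_actP] supplies the product neighbourhood [V] times [W * A]. The
    family [S] is kept apart from the topology of [X] so that a coarser topology can be generated
    from the original open sets. *)
Lemma continuous_action_subbasis (G0 G X : topologicalType) (C : groupoid G0 G)
    (p : X -> G0) (alpha : groupoid_action C p) (S : set (set X)) :
  {within composable C, continuous (fun gh : G * G => mul C gh.1 gh.2)} ->
  @second_countable G ->
  vaught_sets alpha S `<=` open ->
  open `<=` smallest (@is_topology X) (vaught_sets alpha S) ->
  continuous_action alpha.
Proof.
move=> mc /second_countableP[b bb] VSo oVS; apply/continuous_withinP.
pose Op := [set V : set X | forall g a, src C g = p a -> V (alpha g a) ->
  exists W : set (G * X), [/\ open W, W (g, a) & fiber_product C p `&` W `<=`
     [set ga | V (alpha ga.1 ga.2)]]].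
suff OpP : is_topology Op /\ vaught_sets alpha S `<=` Op.
  by move=> [g a] V ga /oVS /(_ _ OpP); exact.
split.
  split=> [g a ga _|V1 V2 N1 N2 g a ga [/N1 -/(_ ga)[W1 [oW1 W1g W1V]]]|].
  - by exists setT; split=> //; exact: openT.
  - move=> /N2 -/(_ ga)[W2 [oW2 W2g W2V]]; exists (W1 `&` W2); split=> //.
      exact: openI.
    by move=> x [Fx [W1x W2x]]; split; [exact: W1V | exact: W2V].
  - move=> F FO g a ga [V FV /(FO V FV) -/(_ ga)[W [oW Wg WV]]].
    exists W; split=> // x Wx; exists V => //; exact: WV.
move=> _ [U [A [oU SA ->]]] g a ga /(vaught_actP alpha mc bb A oU ga).
move=> [V [W [oV oW Vg VW Wa]]]; exists (V `*` vaught alpha W A); split=> //.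
  by apply: open_setX => //; apply: VSo; exists W, A.
move=> [g' a'] /= [ga' [/= Vg' Wa']].
by apply/(vaught_actP alpha mc bb A oU ga'); exists V, W.
Qed.

(** * Object space and Baire category on target fibers *)

Section Groupoid.
Variables (R : realType) (G0 G : topologicalType) (C : groupoid G0 G).
Hypothesis hG : quasi_polish_groupoid R C.

(** [idm] embeds [G0] into [G] with continuous left inverse [src], so separation, and likewise a
    countable base, pass from [G] to [G0]. *)
Lemma objects_kolmogorov : kolmogorov_space G0.
Proof.
have [[_ _ _ idm_c _] /quasi_polish_kolmogorov/kolmogorovP T0] := hG.
apply/kolmogorovP => x y xy; rewrite -(src_idm C x) -(src_idm C y).
congr (src C _); apply: T0 => U oU.
by apply: (xy (idm C @^-1` U)); move/continuousP: idm_c; exact.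
Qed.

Lemma objects_base : exists o : nat -> set G0, indexed_base o.
Proof.
have [[src_c _ _ idm_c _] [/second_countableP[b [bo bn]] _]] := hG.
exists (fun n => idm C @^-1` b n); split.
  by move=> n; move/continuousP: idm_c; exact.
move=> x U oU Ux; have [||n bnx bnU] := bn (idm C x) (src C @^-1` U).
- by move/continuousP: src_c; exact.
- by rewrite /= src_idm.
by exists n => // y /bnU /=; rewrite src_idm.
Qed.

(** As [G0] is T0, the fiber consists of the [g] whose target lies in the same basic sets as [x].
    Each such condition is an implication between open sets, with [setT] as premise or [set0] as
    conclusion. *)
Lemma approximable_target_fiber x : approximable (target_fiber C x).
Proof.
have [[_ tgt_c _ _ _] qG] := hG; have [e [oe en]] := objects_base.
have /kolmogorovP T0 := objects_kolmogorov.
have ote n : open (tgt C @^-1` e n) by move/continuousP: tgt_c; exact.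
pose U n := if pselect (e n x) then setT else tgt C @^-1` e n.
pose V n := if pselect (e n x) then tgt C @^-1` e n else set0.
rewrite (_ : target_fiber C x = [set: G] `&` [set g | forall n, U n g -> V n g]).
  apply: approximable_implications; first exact: quasi_polish_approximable qG.
    by move=> n; rewrite /U; case: pselect => enx //=; exact: openT.
  by move=> n; rewrite /V; case: pselect => enx //=; exact: open0.
rewrite setTI /target_fiber; apply/seteqP; split=> [g /= gx n|g /= gUV].
  by rewrite /U /V; case: pselect => //= enx; rewrite gx.
have enP n : e n (tgt C g) <-> e n x.
  by have := gUV n; rewrite /U /V; case: pselect => enx /= H; split=> // Hn;
    by [exact: H | case: (H Hn)].
apply: T0 => W oW; split=> Wx.
  by have [n nx nW] := en _ W oW Wx; apply: nW; apply/enP.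
by have [n nx nW] := en _ W oW Wx; apply: nW; apply/enP.
Qed.

Lemma target_fiber_baire x U : open U -> target_fiber C x `&` U !=set0 ->
  ~ meager_in (target_fiber C x) U.
Proof. by apply: approximable_baire; exact: approximable_target_fiber. Qed.

Lemma open_tgt : open_groupoid C -> forall U, open U -> open (tgt C @` U).
Proof.
have [[_ _ _ _ inv_c] _] := hG; move=> hGo U oU.
rewrite (_ : tgt C @` U = src C @` (inv C @^-1` U)).
  by apply: hGo; move/continuousP: inv_c; exact.
apply/seteqP; split=> _ [g Ug <-].
  by exists (inv C g); [rewrite /= inv_inv | rewrite src_inv].
by exists (inv C g) => //; rewrite tgt_inv.
Qed.

End Groupoid.

(** * Vaught transforms under a continuous action *)

Section Action.
Variables (R : realType) (G0 G X : topologicalType) (C : groupoid G0 G).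
Variables (p : X -> G0) (alpha : groupoid_action C p).
Hypotheses (hG : quasi_polish_groupoid R C) (hp : continuous p).

Lemma vaught_baire U (A : set X) a g : open U -> U g -> tgt C g = p a ->
  (forall h, U h -> tgt C h = p a -> A (alpha (inv C h) a)) ->
  vaught alpha U A a.
Proof.
move=> oU Ug ga UA; apply/vaughtE => m.
apply: (@target_fiber_baire _ _ _ C hG (p a) U) => //; first by exists g.
by apply: meager_inS m => h [ha Uh]; split=> //=; exact: UA.
Qed.

Lemma vaughtTT a : vaught alpha [set: G] [set: X] a.
Proof.
apply: (@vaught_baire _ _ _ (idm C (p a))) => //; first exact: openT.
by rewrite tgt_idm.
Qed.

Lemma continuous_action_open (hc : continuous_action alpha) g a V :
  src C g = p a -> open V -> V (alpha g a) ->
  exists U A, [/\ open U, open A, U g, A a &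
    forall g' a', U g' -> A a' -> src C g' = p a' -> V (alpha g' a')].
Proof.
move/continuous_withinP: hc => hc ga oV Va.
have [W [oW Wga WV]] := hc (g, a) V ga oV Va.
have [U [A [oU oA Ug Aa UA]]] := open_setX_base oW Wga.
exists U, A; split=> // g' a' Ug' Aa' ga'.
by apply: (WV (g', a')); split=> //; exact: UA.
Qed.

Lemma vaught_open_of_continuous (hGo : open_groupoid C)
    (hc : continuous_action alpha) :
  vaught_sets alpha open `<=` open.
Proof.
have [[_ tgt_c _ _ inv_c] _] := hG.
move=> _ [U [A [oU oA ->]]]; apply: open_pointwise => a aUA.
have [g [Ug ga Aga]] := vaught_nonempty aUA.
have gi : src C (inv C g) = p a by rewrite src_inv.
have [U1 [N [oU1 oN U1g Na U1N]]] := continuous_action_open hc gi oA Aga.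
(* Inverses of elements of [U2] carry [N] into [A]. Since [tgt] is open, [U2] meets the fibers of
   all points near [a], and [vaught_baire] applies there. *)
pose U2 := U `&` (inv C @^-1` U1).
have oU2 : open U2 by apply: openI => //; move/continuousP: inv_c; exact.
exists (N `&` (p @^-1` (tgt C @` U2))); split.
- by apply: openI => //; move/continuousP: hp; apply; exact: (open_tgt hG hGo).
- by split=> //; exists g.
move=> a' [Na' [h U2h ha']].
apply: (@vaughtS _ _ _ _ _ alpha U2 U A A) => //; first by move=> ? [].
apply: (vaught_baire oU2 U2h ha') => k [_ U1k] ka'.
by apply: U1N => //; rewrite src_inv.
Qed.

(** Points of [U * A] have the form [g x] with [g] in [U] and [x] in [A], so continuity at the
    identity and [a] keeps [U * A] inside a given neighbourhood of [a]. *)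
Lemma vaught_basis_of_continuous (hGo : open_groupoid C)
    (hc : continuous_action alpha) : basis (vaught_sets alpha open).
Proof.
have [[_ _ _ _ inv_c] _] := hG.
split; first exact: vaught_open_of_continuous.
move=> a V'; rewrite nbhsE => -[V [oV Va] VV'].
have ia : src C (idm C (p a)) = p a by rewrite src_idm.
have [|U [A [oU oA Ui Aa UA]]] := continuous_action_open hc ia oV.
  by rewrite act_idm.
(* Continuity at the inverse of the identity is what places [a] itself in [U * A]. *)
have [|||U1 [N [oU1 oN U1i Na U1N]]] :=
    @continuous_action_open hc (inv C (idm C (p a))) a A.
- by rewrite src_inv tgt_idm.
- exact: oA.
- by rewrite inv_idm act_idm.
exists (vaught alpha U A); first split.
- by exists U, A.
- pose U2 := U `&` (inv C @^-1` U1).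
  apply: (@vaughtS _ _ _ _ _ alpha U2 U A A) => //; first by move=> ? [].
  apply: (@vaught_baire _ _ _ (idm C (p a))) => //.
  + by apply: openI => //; move/continuousP: inv_c; exact.
  + by rewrite tgt_idm.
  + by move=> h [_ U1h] ha; apply: U1N => //; rewrite src_inv.
move=> a' aUA; have [g [Ug ga' Aga]] := vaught_nonempty aUA; apply: VV'.
rewrite -(act_Kinv alpha ga'); apply: UA => //.
by rewrite act_inv_proj.
Qed.

End Action.

(** * The coarser topology *)

Section Coarser.
Variables (R : realType) (G0 G X : topologicalType) (C : groupoid G0 G).
Variables (p : X -> G0) (alpha : groupoid_action C p).
Hypotheses (hG : quasi_polish_groupoid R C) (hX : quasi_polish R X).
Hypothesis hp : continuous p.
Variables (b : nat -> set G) (b_base : indexed_base b).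
Variables (c : nat -> set X) (c_base : indexed_base c).

(** The relevant part of the fiber is a countable union of pieces given by basic sets inside [U] and
    [A]; if it is nonmeager, so is one piece. *)
Lemma vaught_base U A a : open U -> open A -> vaught alpha U A a ->
  exists i j, [/\ b i `<=` U, c j `<=` A & vaught alpha (b i) (c j) a].
Proof.
move=> oU oA /vaughtE nm; apply: contrapT => nij; apply: nm.
pose good (ij : nat * nat) := b ij.1 `<=` U /\ c ij.2 `<=` A.
apply: (@meager_inS _ _ _ (\bigcup_ij [set g | good ij /\
    (b ij.1 `&` [set g | c ij.2 (alpha (inv C g) a)]) g])).
  move=> g [ga [Ug Ag]]; have [_ /(_ g U oU Ug)[i ig iU]] := b_base.
  have [_ /(_ _ A oA Ag)[j ja jA]] := c_base.
  by exists (i, j).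
apply: meager_in_bigcup => -[i j].
have [[/= iU jA]|ngood] := pselect (good (i, j)); last first.
  by apply: meager_inS (meager_in0 _) => k [_ [/ngood]].
apply: contrapT => nm; apply: nij; exists i, j; split=> //.
by apply/vaughtE => m; apply: nm; apply: meager_inS m => k [_ []].
Qed.

(** By [vaught_base] the local choices of [U] and [A] can be made in the countable bases, so
    arbitrary unions of sets [U * A] reduce to countable ones. *)
Lemma vaught_unionsP V : vaught_unions alpha open V <->
  forall a, V a -> exists U A,
    [/\ open U, open A, vaught alpha U A a & vaught alpha U A `<=` V].
Proof.
split=> [[F [_ FV ->]] a [W FW Wa]|H].
  have [U [A [oU oA WE]]] := FV W FW; exists U, A; rewrite -WE; split=> //.
  by move=> x Wx; exists W.
exists ((fun ij : nat * nat => vaught alpha (b ij.1) (c ij.2)) @`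
  [set ij | vaught alpha (b ij.1) (c ij.2) `<=` V]); split.
- exact: sub_countable (card_image_le _ _) _.
- move=> _ [[i j] _ <-]; exists (b i), (c j); split=> //.
    by have [] := b_base.
  by have [] := c_base.
- apply/seteqP; split=> [a Va|a [_ [ij ijV <-] /ijV]//].
  have [U [A [oU oA UAa UAV]]] := H a Va.
  have [i [j [iU jA ija]]] := vaught_base oU oA UAa.
  exists (vaught alpha (b i) (c j)) => //; exists (i, j) => //.
  exact: subset_trans (vaughtS iU jA) UAV.
Qed.

Hypothesis vaught_open : vaught_sets alpha open `<=` open.

Let mul_c : {within composable C, continuous (fun gh : G * G => mul C gh.1 gh.2)}.
Proof. by have [[]] := hG. Qed.

Lemma vaught_setI U1 A1 U2 A2 a :
  open U1 -> open A1 -> open U2 -> open A2 ->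
  vaught alpha U1 A1 a -> vaught alpha U2 A2 a ->
  exists U A, [/\ open U, open A, vaught alpha U A a &
    vaught alpha U A `<=` vaught alpha U1 A1 `&` vaught alpha U2 A2].
Proof.
have [[_ _ _ _ inv_c] _] := hG.
move=> oU1 oA1 oU2 oA2.
have ia : src C (idm C (p a)) = p a by rewrite src_idm.
rewrite -{1 2}(act_idm alpha a) !(vaught_actP alpha mul_c b_base) //.
move=> [V1 [W1 [oV1 oW1 V1i VW1 W1a]]] [V2 [W2 [oV2 oW2 V2i VW2 W2a]]].
pose E := vaught alpha W1 A1 `&` vaught alpha W2 A2.
have oE : open E by apply: openI; apply: vaught_open; [exists W1, A1|exists W2, A2].
exists (V1 `&` V2), E; split=> //; first exact: openI.
  (* Membership in [W1 * A1] and [W2 * A2] persists from [a] to [inv C h] applied to [a] for [h]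
     near the identity; so [E] holds along an open part of the fiber, and [vaught_baire] applies. *)
  have near_id U A : open U -> vaught alpha U A a ->
      exists N, [/\ open N, N (idm C (p a)) & forall h, N h -> tgt C h = p a ->
        vaught alpha U A (alpha (inv C h) a)].
    move=> oU; rewrite -{1}(act_idm alpha a) (vaught_actP alpha mul_c b_base) //.
    move=> [V [W [oV oW Vi VW Wa]]]; exists (inv C @^-1` V); split.
    - by move/continuousP: inv_c; exact.
    - by rewrite /= inv_idm.
    move=> h Vh ha; have hi : src C (inv C h) = p a by rewrite src_inv.
    by apply/(vaught_actP alpha mul_c b_base A oU hi); exists V, W.
  have [N1 [oN1 N1i N1P]] := near_id _ _ oW1 W1a.
  have [N2 [oN2 N2i N2P]] := near_id _ _ oW2 W2a.
  apply: (@vaughtS _ _ _ _ _ alpha ((V1 `&` V2) `&` (N1 `&` N2)) _ E) => //.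
  apply: (@vaught_baire _ _ _ _ _ _ alpha hG _ _ _ (idm C (p a))).
  - by apply: openI; exact: openI.
  - by [].
  - by rewrite tgt_idm.
  - by move=> h [_ [N1h N2h]] ha; split; [exact: N1P | exact: N2P].
move=> a' aE; have [g [[V1g V2g] ga' [Wg1 Wg2]]] := vaught_nonempty aE.
have gi := act_inv_proj alpha ga'.
rewrite -(act_Kinv alpha ga').
split; apply/(vaught_actP alpha mul_c b_base) => //.
  by exists V1, W1.
by exists V2, W2.
Qed.

Lemma vaught_unions_topology : is_topology (vaught_unions alpha open).
Proof.
split=> [|V1 V2 /vaught_unionsP H1 /vaught_unionsP H2|F FV]; apply/vaught_unionsP.
- move=> a _; exists setT, setT; split=> //; [exact: openT | exact: openT |].
  exact: (vaughtTT hG (a := a)).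
- move=> a [/H1[U1 [A1 [oU1 oA1 a1 V1P]]] /H2[U2 [A2 [oU2 oA2 a2 V2P]]]].
  have [U [A [oU oA UAa UAV]]] := vaught_setI oU1 oA1 oU2 oA2 a1 a2.
  exists U, A; split=> // x /UAV[? ?]; split; [exact: V1P | exact: V2P].
- move=> a [V FV1 Va]; have /vaught_unionsP/(_ a Va) := FV V FV1.
  move=> [U [A [oU oA UAa UAV]]]; exists U, A; split=> // x /UAV Vx.
  by exists V.
Qed.

(* [x] is generic if every neighbourhood of [x] is visited by the orbit of [x]
   at nonmeagerly many group elements near the identity. These points form a
   Pi^0_2 set on which the action becomes an open map onto the coarser
   space. *)
Let generic (x : X) := forall ij : nat * nat,
  c ij.2 x -> b ij.1 (idm C (p x)) -> vaught alpha (b ij.1) (c ij.2) x.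

(** Factor [g] as [g] times an identity: continuity of [mul] gives [V] and [W] with [W] around that
    identity, and genericity puts [x] in [W * A]. This serves to show that the action on generic
    points is open. *)
Let generic_vaught U A g x : open U -> open A -> U g -> A x ->
  src C g = p x -> generic x -> vaught alpha U A (alpha g x).
Proof.
move=> oU oA Ug Ax gx xgen; apply/(vaught_actP alpha mul_c b_base A oU gx).
have [|||V [W [oV oW Vg Wi VW]]] := @mul_open _ _ C mul_c g (idm C (src C g)) U.
- by rewrite tgt_idm.
- exact: oU.
- by rewrite mul_idmr.
exists V, W; split=> //.
have [_ /(_ _ W oW Wi)[i ig iW]] := b_base.
have [_ /(_ x A oA Ax)[j jx jA]] := c_base.
apply: (vaughtS iW jA); apply: (xgen (i, j)) => //=.
by rewrite -gx.
Qed.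

(** For each of the countably many basic pairs with [a] outside [b n * c j], the corresponding part
    of the fiber is meager. Any [g] avoiding all of them sends [a] back to a generic point. *)
Let vaught_generic U A a : vaught alpha U A a -> exists g,
  [/\ U g, tgt C g = p a, A (alpha (inv C g) a) & generic (alpha (inv C g) a)].
Proof.
move=> /vaughtE nm; apply: contrapT => ng; apply: nm.
pose bad (nj : nat * nat) := ~ vaught alpha (b nj.1) (c nj.2) a.
apply: (@meager_inS _ _ _ (\bigcup_nj [set g | bad nj /\
    (b nj.1 `&` [set g | c nj.2 (alpha (inv C g) a)]) g])); last first.
  apply: meager_in_bigcup => nj.
  have [bnj|nbad] := pselect (bad nj); last first.
    by apply: meager_inS (meager_in0 _) => k [_ [/nbad]].
  apply: (@meager_inS _ _ _ (b nj.1 `&` [set g | c nj.2 (alpha (inv C g) a)])).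
    by move=> k [_ []].
  by apply: contrapT => nm; apply: bnj; apply/vaughtE.
move=> g [ga [Ug Ag]].
have /existsNP[[i j] /= /not_implyP[cja /not_implyP[big nv]]] :
    ~ generic (alpha (inv C g) a) by move=> ggen; apply: ng; exists g.
have gi : src C (inv C g) = tgt C g by rewrite src_inv.
(* The identity at [src C g] is rewritten as [inv C g] times [g], so that continuity of [mul] there
   yields a neighbourhood [W] of [g]. *)
move: big; rewrite act_inv_proj // -mul_invl => big.
have [V [W [oV oW Vg Wg VW]]] := mul_open mul_c gi (proj1 b_base i) big.
have [_ /(_ g W oW Wg)[n ng' nW]] := b_base.
exists (n, j) => //; split=> // nva; apply: nv.
apply/(vaught_actP alpha mul_c b_base) => //; first by have [] := b_base.
  by rewrite gi.
exists V, W; split=> //; exact: (vaughtS nW (@subset_refl _ (c j)) nva).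
Qed.

Let generic_set : set (G * X) := fiber_product C p `&` [set gx | generic gx.2].

Lemma approximable_generic_set : approximable generic_set.
Proof.
have [[src_c _ _ idm_c _] qG] := hG; have [e [oe en]] := objects_base hG.
have /kolmogorovP T0 := objects_kolmogorov hG.
(* The two [inl] families express [src C g = p x] through the T0 property of [G0]; the [inr] family
   expresses genericity, with open conclusions by [vaught_open]. *)
pose U (k : nat + nat + nat * nat) : set (G * X) := match k with
  | inl (inl n) => (src C @^-1` e n) `*` setT
  | inl (inr n) => setT `*` (p @^-1` e n)
  | inr (i, j) => setT `*` (c j `&` (idm C \o p) @^-1` b i) end.
pose V (k : nat + nat + nat * nat) : set (G * X) := match k with
  | inl (inl n) => setT `*` (p @^-1` e n)
  | inl (inr n) => (src C @^-1` e n) `*` setT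
  | inr (i, j) => setT `*` vaught alpha (b i) (c j) end.
have os n : open (src C @^-1` e n) by move/continuousP: src_c; exact.
have op n : open (p @^-1` e n) by move/continuousP: hp; exact.
rewrite (_ : generic_set =
  ([set: G] `*` [set: X]) `&` [set x | forall k, U k x -> V k x]).
  apply: approximable_implications.
  - by apply: approximableX; apply: quasi_polish_approximable; eassumption.
  - move=> [[n|n]|[i j]] /=; apply: open_setX => //; try exact: openT.
    apply: openI; first by have [] := c_base.
    have /continuousP : continuous (idm C \o p).
      by move=> x; apply: continuous_comp; [exact: hp | exact: idm_c].
    by apply; have [] := b_base.
  - move=> [[n|n]|[i j]] /=; apply: open_setX => //; try exact: openT.
    apply: vaught_open; exists (b i), (c j); split=> //.
      by have [] := b_base.
    by have [] := c_base.
apply/seteqP; split=> [[g x] [/= gx xgen]|[g x] [_ /= UV]].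
  split=> // -[[n|n]|[i j]] [/=].
  - by rewrite /fiber_product /= in gx; rewrite gx.
  - by rewrite /fiber_product /= in gx; rewrite gx.
  - by move=> _ [cx bx]; split=> //; exact: (xgen (i, j)).
split; last by move=> [i j] /= cx bx; have [] := UV (inr (i, j)).
apply: T0 => W oW; split=> Wx; have [n nx nW] := en _ W oW Wx; apply: nW.
  by have [] := UV (inl (inl n)).
by have [] := UV (inl (inr n)).
Qed.

Lemma vaught_in_unions U A : open U -> open A ->
  vaught_unions alpha open (vaught alpha U A).
Proof.
by move=> oU oA; apply/vaught_unionsP => x Ux; exists U, A; split.
Qed.

Lemma vaught_unions_proj W : open W -> vaught_unions alpha open (p @^-1` W).
Proof.
have [[_ tgt_c _ _ _] _] := hG; move=> oW; apply/vaught_unionsP => a Wa.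
have otW : open (tgt C @^-1` W) by move/continuousP: tgt_c; exact.
exists (tgt C @^-1` W), setT; split=> //; first exact: openT.
  apply: (vaught_baire hG otW (g := idm C (p a))) => //=; by rewrite tgt_idm.
by move=> a' aW; have [g [Wg ga _]] := vaught_nonempty aW; rewrite /= -ga.
Qed.

(** The sets of pairs whose pullback along [inv C g] paired with [a] has the Baire property in the
    fiber form a sigma-algebra containing the open traces, hence the Borel preimage of [A]. *)
Lemma act_inv_baire_property A a : borel_action alpha -> open A ->
  baire_property_in (target_fiber C (p a)) [set g | A (alpha (inv C g) a)].
Proof.
move=> halpha oA; have [[_ _ _ _ inv_c] _] := hG.
have FP g : target_fiber C (p a) g -> fiber_product C p (inv C g, a).
  by move=> ga; rewrite /fiber_product /= src_inv ga.
pose BP := [set E : set (G * X) |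
  baire_property_in (target_fiber C (p a)) [set g | E (inv C g, a)]].
suff /smallest_sub BPP : sigma_algebra (fiber_product C p) BP.
  have : BP (fiber_product C p `&` [set ga : G * X | A (alpha ga.1 ga.2)]).
    apply: BPP; last by apply: halpha; exact: sub_sigma_algebra.
    move=> _ [U oU <-].
    have oi : open [set g | U (inv C g, a)].
      apply: open_pointwise => g Ug.
      have [V [N [oV oN Vg Na VN]]] := open_setX_base oU Ug.
      exists (inv C @^-1` V); split=> //; first by move/continuousP: inv_c; exact.
      by move=> h Vh; apply: VN.
    apply: eq_baire_property_in (baire_property_in_open _ oi).
    by apply/seteqP; split=> g [ga] => [Ug|[_ Ug]]; split=> //; split=> //; exact: FP.
  apply: eq_baire_property_in.
  by apply/seteqP; split=> g [ga] => [[_ Ag]|Ag]; split=> //; split=> //; exact: FP.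
split.
- exact: baire_property_in_open open0.
- move=> E /baire_property_inC; apply: eq_baire_property_in.
  by apply/seteqP; split=> g [ga] => [nE|[_ nE]]; split=> //; split=> //; exact: FP.
- move=> E EP; have := baire_property_in_bigcup EP.
  apply: eq_baire_property_in.
  by apply/seteqP; split=> g [ga] [n _ En]; split=> //; exists n.
Qed.

Lemma coarser_kolmogorov (HO : is_topology (vaught_unions alpha open)) :
  borel_action alpha -> kolmogorov_space (retopology HO).
Proof.
move=> halpha; apply/kolmogorovP => x y; rewrite open_retopology => xy.
have pxy : p x = p y.
  have /kolmogorovP := objects_kolmogorov hG; apply => W oW.
  exact: (xy _ (vaught_unions_proj oW)).
pose D j z := [set g | c j (alpha (inv C g) z)].
(* A nonmeager difference would be comeager in some open [Q] meeting the fiber; then [Q * c j] would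
   contain [a] but not [a']. *)
have diff j a a' : p a = p a' ->
    (forall V, vaught_unions alpha open V -> V a <-> V a') ->
    meager_in (target_fiber C (p a)) (D j a `\` D j a').
  move=> paa' aa'; have cj : open (c j) by have [] := c_base.
  have bp : baire_property_in (target_fiber C (p a)) (D j a `\` D j a').
    apply: baire_property_inD; first exact: act_inv_baire_property.
    by rewrite paa'; exact: act_inv_baire_property.
  have [Q [oQ DQ QD]] := bp; apply: contrapT => nm.
  have [Qne|Q0] := pselect (target_fiber C (p a) `&` Q !=set0); last first.
    apply: nm; apply: meager_inS DQ => g [ga Dg]; split=> // Qg.
    by apply: Q0; exists g.
  have Qa : vaught alpha Q (c j) a.
    apply/vaughtE => m; apply: (target_fiber_baire hG oQ Qne).
    apply: meager_inS (meager_inU m QD) => g [ga Qg].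
    have [[Dg _]|nDg] := pselect ((D j a `\` D j a') g); [by left | by right].
  have /vaughtE := (aa' _ (vaught_in_unions oQ cj)).1 Qa.
  apply; rewrite -paa'; apply: meager_inS QD => g [_ [Qg Dg]].
  by split=> // -[].
pose E := \bigcup_j ((D j x `\` D j y) `|` (D j y `\` D j x)).
have mE : meager_in (target_fiber C (p x)) E.
  apply: meager_in_bigcup => j; apply: meager_inU; first exact: diff.
  by rewrite pxy; apply: diff => // V VV; split=> /(xy V VV).
(* For [g] outside the meager set [E], the points that [inv C g] makes of [x] and [y] lie in the
   same basic open sets, so they agree as [X] is T0. *)
have [g [gx nE]] : exists g, target_fiber C (p x) g /\ ~ E g.
  apply: contrapT => ng; apply: (target_fiber_baire hG openT (x := p x)).
    by exists (idm C (p x)); rewrite setIT /target_fiber /= tgt_idm.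
  apply: meager_inS mE => g [gx _]; apply: contrapT => nE.
  by apply: ng; exists g.
have gy : tgt C g = p y by rewrite -pxy.
rewrite -(act_Kinv alpha gx) -(act_Kinv alpha gy); congr (alpha g _).
have DP j : D j x g <-> D j y g.
  split=> Dg; apply: contrapT => nD; apply: nE; exists j => //; first by left.
  by right.
have /quasi_polish_kolmogorov/kolmogorovP := hX; apply => U oU.
by split=> Uz; have [_ /(_ _ U oU Uz)[j jz jU]] := c_base; apply/jU/DP.
Qed.

Lemma coarser_quasi_polish (HO : is_topology (vaught_unions alpha open)) :
  borel_action alpha -> quasi_polish R (retopology HO).
Proof.
move=> halpha; have [I [s0 [B [prec apx]]]] := approximable_generic_set.
have oV V : @open (retopology HO) V -> vaught_unions alpha open V by [].
apply: (@open_image_quasi_polish (G * X)%type (retopology HO) generic_set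
  (fun gx => alpha gx.1 gx.2) _ _ _ I s0 B prec apx (nat * nat)%type
  (fun ij => vaught alpha (b ij.1) (c ij.2))).
- move=> [g x] V [/= gx xgen] /oV /vaught_unionsP VP /VP[U [A [oU oA UAg UAV]]].
  have [V1 [W1 [oV1 oW1 V1g VW Wx]]] :=
    (vaught_actP alpha mul_c b_base A oU gx).1 UAg.
  exists (V1 `*` vaught alpha W1 A); split=> //.
    by apply: open_setX => //; apply: vaught_open; exists W1, A.
  move=> [g' x'] [[/= gx' _] [/= Vg' Wx']]; apply: UAV.
  by apply/(vaught_actP alpha mul_c b_base A oU gx'); exists V1, W1.
- move=> W oW; apply/vaught_unionsP => _ [[g x] [[/= gx xgen] Wgx] <-].
  have [U [A [oU oA Ug Ax UAW]]] := open_setX_base oW Wgx.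
  exists U, A; split=> //; first exact: generic_vaught.
  move=> a /vaught_generic[h [Uh ha Aha hgen]].
  exists (h, alpha (inv C h) a); last exact: act_Kinv.
  split; last exact: UAW.
  by split=> //=; rewrite /fiber_product /= act_inv_proj.
- move=> a; have [g [_ ga _ ggen]] := vaught_generic (vaughtTT hG (a := a)).
  exists (g, alpha (inv C g) a); last exact: act_Kinv.
  by split=> //=; rewrite /fiber_product /= act_inv_proj.
- split=> [[i j]|x U /oV /vaught_unionsP UP /UP[V [A [oV' oA VAx VAU]]]].
    by apply: vaught_in_unions; [have [] := b_base | have [] := c_base].
  have [i [j [iV jA ijx]]] := vaught_base oV' oA VAx.
  by exists (i, j) => //; exact: subset_trans (vaughtS iV jA) VAU.
- exact: coarser_kolmogorov.
Qed.

End Coarser.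

Theorem theorem4p3p1 (R : realType) (G0 G X : topologicalType)
    (C : groupoid G0 G) (p : X -> G0) (alpha : groupoid_action C p)
    (hG : quasi_polish_groupoid R C) (hGopen : open_groupoid C)
    (hX : quasi_polish R X) (hp : continuous p)
    (halpha : borel_action alpha) :
  [/\ continuous_action alpha <-> vaught_unions alpha (@open X) = @open X,
      continuous_action alpha <-> basis (vaught_sets alpha (@open X))
    & continuous_action alpha <-> subbasis (vaught_sets alpha (@open X))] /\
  (vaught_unions alpha (@open X) `<=` @open X ->
   exists HO : is_topology (vaught_unions alpha (@open X)),
     [/\ @open (retopology HO) `<=` @open X,
         @open (retopology HO) `<=` @borel X,
         quasi_polish R (retopology HO),
         continuous (p : retopology HO -> G0)
       & continuous_action
           (alpha : groupoid_action C (p : retopology HO -> G0))]).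
Proof.
have [[_ _ mul_c _ _] [scG _]] := hG; have [scX _] := hX.
have /second_countableP[b bb] := scG; have /second_countableP[c cc] := scX.
have sets_unions : vaught_sets alpha open `<=` vaught_unions alpha open.
  by move=> _ [U [A [oU oA ->]]]; exact: (vaught_in_unions alpha bb cc).
have cont_basis : continuous_action alpha -> basis (vaught_sets alpha open).
  exact: (vaught_basis_of_continuous hG hp hGopen).
have sub_cont : subbasis (vaught_sets alpha open) -> continuous_action alpha.
  by move=> [Vo Vs]; apply: continuous_action_subbasis Vo _ => //; rewrite -Vs.
have unions_sub : vaught_unions alpha open = open ->
    subbasis (vaught_sets alpha open).
  move=> VE; have Vo : vaught_sets alpha open `<=` open.
    by apply: subset_trans sets_unions _; rewrite VE.
  split=> //; apply/seteqP; split.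
    by rewrite -{1}VE; exact: vaught_unions_smallest.
  apply: smallest_sub => //; split; [exact: openT | exact: openI |].
  by move=> F Fo; exact: bigcup_open.
split.
  (* Continuity gives a basis, thus a subbasis, thus continuity again; second countability of [X]
     turns the basis into the equality with [vaught_unions], which in turn gives a subbasis. *)
  split; split=> H.
  - have [Vo Vn] := cont_basis H; apply/seteqP; split=> U.
      by move=> [F [_ FV ->]]; apply: bigcup_open => V /FV; exact: Vo.
    by move=> oU; exact: (basis_countable_union scX (conj Vo Vn)).
  - exact/sub_cont/unions_sub.
  - exact: cont_basis.
  - exact/sub_cont/basis_subbasis.
  - exact/basis_subbasis/cont_basis.
  - exact: sub_cont.
move=> Vo; have vo := subset_trans sets_unions Vo.
pose HO := vaught_unions_topology hG bb cc vo; exists HO; split.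
- exact: Vo.
- by move=> V /Vo oV; exact: sub_sigma_algebra.
- exact: (coarser_quasi_polish hG hX hp bb cc vo).
- by apply/continuousP => W oW; exact: (vaught_unions_proj alpha hG bb cc).
(* The family [S] is the original topology of [X], while continuity is for the coarser one generated
   by the sets [U * A]. *)
- refine (@continuous_action_subbasis G0 G (retopology HO) C p alpha (@open X)
    mul_c scG _ _); first exact: sets_unions.
  exact: vaught_unions_smallest.
Qed.
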